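(* There are algorithms which (a) given a square substochastic matrix of order $n$, decide whether it is convergent, and (b) given a square complex w.d.d. matrix of order $n$, decide whether it is a nonsingular M-matrix. In each case the running time is linear in $n$ if the input matrix is sparse and quadratic in $n$ if it is dense; that is, $O(n)$ operations suffice for inputs with at most $c$ nonzero entries per row ($c$ any fixed constant) stored in a sparse row format, and $O(n^2)$ operations suffice for inputs stored as dense two-dimensional arrays.
   Context: A substochastic matrix is a real matrix $B=(b_{ij})$ with $b_{ij}\ge 0$ for all $i,j$ and $\sum_j b_{ij}\le 1$ for all $i$. A square matrix $B$ is convergent if $B^k\to0$ as $k\to\infty$. A square complex matrix $A=(a_{ij})$ is weakly diagonally dominant (w.d.d.) if $|a_{ii}|\ge\sum_{j\ne i}|a_{ij}|$ for every $i$. An M-matrix is a square matrix $A$ that can be written $A=sI-B$ where $B$ is an entrywise nonnegative matrix and $s\ge\rho(B)$, with $\rho(B)$ the spectral radius of $B$. Computational model: exact arithmetic, each arithmetic operation or comparison on numbers and each elementary random-access-machine step (array access, list append, queue enqueue/dequeue, integer operations) costs one operation. ''Sparse'' means that the maximum number of nonzero entries per row is bounded independently of $n$; a sparse row format (e.g. compressed sparse row) is one in which the nonzero entries of a given row, with their column indices, can be enumerated in time proportional to their number (up to an additive constant). *)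

(* Defs.v *)
From HB Require Import structures.
From mathcomp Require Import all_boot all_order all_algebra.
From mathcomp Require Import complex.
From mathcomp Require Import all_classical all_reals all_analysis.

Set Implicit Arguments.
Unset Strict Implicit.
Unset Printing Implicit Defensive.

Import Order.TTheory GRing.Theory Num.Theory.
Import numFieldNormedType.Exports ComplexField.Normc.

Local Open Scope classical_set_scope.
Local Open Scope ring_scope.

Definition substochastic (R : realType) (n : nat) (B : 'M[R]_n) : Prop :=
  (forall i j, 0 <= B i j) /\ (forall i, \sum_j B i j <= 1).

Definition convergent (R : realType) (n : nat) (B : 'M[R]_n) : Prop :=
  B ^+ k @[k --> \oo] --> (0 : 'M[R]_n).

Definition wdd (R : realType) (n : nat) (A : 'M[R[i]]_n) : Prop :=
  forall i, \sum_(j | j != i) `|A i j| <= `|A i i|.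

Definition spectral_radius (R : realType) (n : nat) (B : 'M[R]_n) : R :=
  sup [set normc l | l in [set l | eigenvalue (map_mx (real_complex R) B) l]].

Definition M_matrix (R : realType) (n : nat) (A : 'M[R[i]]_n) : Prop :=
  exists (s : R) (B : 'M[R]_n),
    [/\ forall i j, 0 <= B i j, spectral_radius B <= s
      & A = map_mx (real_complex R) (s%:M - B)].

Definition nonsingular_M_matrix (R : realType) (n : nat) (A : 'M[R[i]]_n) :=
  M_matrix A /\ A \in unitmx.

(* A random-access machine over the numbers K, programmed in a structured
   language.  It has natural-number variables and arrays (indices, pointers,
   lists, queues) and number variables and arrays.  A program is a finite
   syntax tree that mentions neither K nor the order of the input matrix; its
   only constants are natural numbers.  There is no conversion from numbers
   to naturals other than branching on a comparison.

   A name is tagged [true] when it belongs to the input data structure and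
   [false] when it belongs to the algorithm. *)
Definition name := (bool * nat)%type.

Inductive iexp : Type :=
  | IVar of name
  | ICst of nat
  | IGet of name & iexp
  | IAdd of iexp & iexp
  | ISub of iexp & iexp  (* truncated *)
  | IMul of iexp & iexp.

Inductive nexp : Type :=
  | NVar of name
  | NCst of nat
  | NGet of name & iexp
  | NAdd of nexp & nexp
  | NSub of nexp & nexp
  | NMul of nexp & nexp
  | NDiv of nexp & nexp.  (* x / 0 is 0 *)

Inductive bexp : Type :=
  | BIEq of iexp & iexp
  | BILe of iexp & iexp
  | BNEq of nexp & nexp
  | BNLe of nexp & nexp
  | BNot of bexp
  | BAnd of bexp & bexp.

Inductive cmd : Type :=
  | Skip
  | ISet of name & iexp
  | NSet of name & nexp
  | IPut of name & iexp & iexp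
  | NPut of name & iexp & nexp
  | Seq of cmd & cmd
  | If of bexp & cmd & cmd
  | While of bexp & cmd.

Record state (K : Type) := State {
  ivar : name -> nat;
  iarr : name -> nat -> nat;
  nvar : name -> K;
  narr : name -> nat -> K
}.

Section Semantics.

Variable K : numFieldType.
Implicit Types s : state K.

Fixpoint ival s e : nat :=
  match e with
  | IVar x => ivar s x
  | ICst k => k
  | IGet a e1 => iarr s a (ival s e1)
  | IAdd e1 e2 => (ival s e1 + ival s e2)%N
  | ISub e1 e2 => (ival s e1 - ival s e2)%N
  | IMul e1 e2 => (ival s e1 * ival s e2)%N
  end.

Fixpoint nval s e : K :=
  match e with
  | NVar x => nvar s x
  | NCst k => k%:R
  | NGet a e1 => narr s a (ival s e1)
  | NAdd e1 e2 => nval s e1 + nval s e2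
  | NSub e1 e2 => nval s e1 - nval s e2
  | NMul e1 e2 => nval s e1 * nval s e2
  | NDiv e1 e2 => nval s e1 / nval s e2
  end.

(* For K = R[i] the order is the partial one, for which x <= y means that
   y - x is real and nonnegative: this amounts to comparing the imaginary
   parts for equality and the real parts for the order of R. *)
Fixpoint bval s e : bool :=
  match e with
  | BIEq e1 e2 => ival s e1 == ival s e2
  | BILe e1 e2 => (ival s e1 <= ival s e2)%N
  | BNEq e1 e2 => nval s e1 == nval s e2
  | BNLe e1 e2 => nval s e1 <= nval s e2
  | BNot e1 => ~~ bval s e1
  | BAnd e1 e2 => bval s e1 && bval s e2
  end.

Definition upd (T : eqType) (V : Type) (f : T -> V) (x : T) (v : V) : T -> V :=
  fun y => if y == x then v else f y.

Definition set_ivar s x v :=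
  State (upd (ivar s) x v) (iarr s) (nvar s) (narr s).
Definition set_nvar s x v :=
  State (ivar s) (iarr s) (upd (nvar s) x v) (narr s).
Definition set_iarr s a k v :=
  State (ivar s) (upd (iarr s) a (upd (iarr s a) k v)) (nvar s) (narr s).
Definition set_narr s a k v :=
  State (ivar s) (iarr s) (nvar s) (upd (narr s) a (upd (narr s a) k v)).

End Semantics.

(* One operation per node, including variable and constant accesses. *)
Fixpoint icost (e : iexp) : nat :=
  match e with
  | IVar _ | ICst _ => 1%N
  | IGet _ e1 => (icost e1).+1
  | IAdd e1 e2 | ISub e1 e2 | IMul e1 e2 => (icost e1 + icost e2).+1
  end.

Fixpoint ncost (e : nexp) : nat :=
  match e with
  | NVar _ | NCst _ => 1%N
  | NGet _ e1 => (icost e1).+1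
  | NAdd e1 e2 | NSub e1 e2 | NMul e1 e2 | NDiv e1 e2 =>
      (ncost e1 + ncost e2).+1
  end.

Fixpoint bcost (e : bexp) : nat :=
  match e with
  | BIEq e1 e2 | BILe e1 e2 => (icost e1 + icost e2).+1
  | BNEq e1 e2 | BNLe e1 e2 => (ncost e1 + ncost e2).+1
  | BNot e1 => (bcost e1).+1
  | BAnd e1 e2 => (bcost e1 + bcost e2).+1
  end.

(* [exec p s t s']: started in s, p halts in s' after t operations. *)
Inductive exec (K : numFieldType) : cmd -> state K -> nat -> state K -> Prop :=
  | ExecSkip s : exec Skip s 1 s
  | ExecISet s x e :
      exec (ISet x e) s (icost e).+1 (set_ivar s x (ival s e))
  | ExecNSet s x e :
      exec (NSet x e) s (ncost e).+1 (set_nvar s x (nval s e))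
  | ExecIPut s a e1 e2 :
      exec (IPut a e1 e2) s (icost e1 + icost e2).+1
           (set_iarr s a (ival s e1) (ival s e2))
  | ExecNPut s a e1 e2 :
      exec (NPut a e1 e2) s (icost e1 + ncost e2).+1
           (set_narr s a (ival s e1) (nval s e2))
  | ExecSeq p q s1 t1 s2 t2 s3 :
      exec p s1 t1 s2 -> exec q s2 t2 s3 ->
      exec (Seq p q) s1 (t1 + t2)%N s3
  | ExecIfTrue e p q s t s' :
      bval s e -> exec p s t s' -> exec (If e p q) s (bcost e + t)%N s'
  | ExecIfFalse e p q s t s' :
      ~~ bval s e -> exec q s t s' -> exec (If e p q) s (bcost e + t)%N s'
  | ExecWhileFalse e p s :
      ~~ bval s e -> exec (While e p) s (bcost e) s
  | ExecWhileTrue e p s1 t1 s2 t2 s3 :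
      bval s1 e -> exec p s1 t1 s2 -> exec (While e p) s2 t2 s3 ->
      exec (While e p) s1 (bcost e + t1 + t2)%N s3.

(* The algorithm finds the order n of the input in [order_reg] and leaves its
   answer, 1 for yes and 0 for no, in [answer_reg].  Memory that is not part
   of the input is not assumed to be initialized. *)
Definition order_reg : name := (false, 0%N).
Definition row_reg : name := (false, 1%N).
Definition answer_reg : name := (false, 2%N).

Definition decides_within (K : numFieldType) (p : cmd) (s : state K)
    (Q : Prop) (T : nat) : Prop :=
  exists t s', [/\ exec p s t s', (t <= T)%N & ivar s' answer_reg = `[< Q >]].

(* A two-dimensional array, laid out in row-major order. *)
Definition dense_array : name := (true, 0%N).

Definition dense_input (K : numFieldType) (n : nat) (A : 'M[K]_n)
    (s : state K) : Prop :=
  ivar s order_reg = n /\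
  forall i j : 'I_n, narr s dense_array (i * n + j)%N = A i j.

Definition row_nnz (K : numFieldType) (n : nat) (A : 'M[K]_n) (i : 'I_n) : nat :=
  #|[set j | A i j != 0]%SET|.

(* A sparse row format consists of a relation [enc], saying how a matrix is
   stored in the names tagged [true], and of a routine [lister] which, given
   a row index in [row_reg], lists the nonzero entries of that row: their
   number in [list_len], their column indices, in any order and without
   repetition, in [list_col] and their values in [list_val].  The routine
   leaves the stored matrix available and the memory of the caller intact. *)
Definition list_len : name := (true, 0%N).
Definition list_col : name := (true, 0%N).
Definition list_val : name := (true, 0%N).

Definition agree (K : numFieldType) (b : bool) (s s' : state K) : Prop :=
  forall k, [/\ ivar s (b, k) = ivar s' (b, k), nvar s (b, k) = nvar s' (b, k),
                iarr s (b, k) =1 iarr s' (b, k)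
              & narr s (b, k) =1 narr s' (b, k)].

Definition lists_row (K : numFieldType) (n : nat) (A : 'M[K]_n) (i : 'I_n)
    (s : state K) : Prop :=
  perm_eq (mkseq (iarr s list_col) (ivar s list_len))
          [seq val j | j <- enum 'I_n & A i j != 0] /\
  forall (k : nat) (j : 'I_n), (k < ivar s list_len)%N ->
    iarr s list_col k = j -> narr s list_val k = A i j.

Definition sparse_row_format (K : numFieldType)
    (enc : forall n : nat, 'M[K]_n -> state K -> Prop) (lister : cmd) : Prop :=
  (forall n (A : 'M[K]_n) s s', agree true s s' -> enc n A s -> enc n A s') /\
  exists a b : nat, forall n (A : 'M[K]_n) (i : 'I_n) s,
    enc n A s -> ivar s row_reg = i ->
    exists t s', [/\ exec lister s t s', (t <= a * row_nnz A i + b)%N,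
                     agree false s s', enc n A s' & lists_row A i s'].

(* Both predicates speak about a decision problem with a promise: given a
   matrix satisfying [D], decide [Q].  In the sparse case the program depends
   on the format but not on the bound c; as every matrix of order n has at
   most n nonzero entries per row, it halts with the correct answer on every
   input satisfying the promise. *)
Definition decidable_linear_sparse (K : numFieldType)
    (D Q : forall n : nat, 'M[K]_n -> Prop) : Prop :=
  forall enc lister, sparse_row_format enc lister ->
  exists p : cmd, forall c : nat, exists C : nat,
    forall (n : nat) (A : 'M[K]_n) (s : state K),
      (0 < n)%N -> D n A -> (forall i, (row_nnz A i <= c)%N) ->
      ivar s order_reg = n -> enc n A s ->
      decides_within p s (Q n A) (C * n)%N.

Definition decidable_quadratic_dense (K : numFieldType)
    (D Q : forall n : nat, 'M[K]_n -> Prop) : Prop :=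
  exists (p : cmd) (C : nat),
    forall (n : nat) (A : 'M[K]_n) (s : state K),
      (0 < n)%N -> D n A -> dense_input A s ->
      decides_within p s (Q n A) (C * n ^ 2)%N.

(* The compressed sparse row format is an instance. *)
Definition csr_ptr : name := (true, 1%N).
Definition csr_col : name := (true, 2%N).
Definition csr_val : name := (true, 1%N).
Definition csr_cursor : name := (true, 1%N).

Definition csr (K : numFieldType) (n : nat) (A : 'M[K]_n) (s : state K) : Prop :=
  forall i : 'I_n, let p := iarr s csr_ptr i in let q := iarr s csr_ptr i.+1 in
  [/\ (p <= q)%N,
      perm_eq [seq iarr s csr_col k | k <- iota p (q - p)]
              [seq val j | j <- enum 'I_n & A i j != 0]
    & forall (k : nat) (j : 'I_n), (p <= k < q)%N ->
        iarr s csr_col k = j -> narr s csr_val k = A i j].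

Definition csr_loop : cmd :=
  While (BNot (BILe (IGet csr_ptr (IAdd (IVar row_reg) (ICst 1)))
                    (IVar csr_cursor)))
    (Seq (IPut list_col (IVar list_len) (IGet csr_col (IVar csr_cursor)))
    (Seq (NPut list_val (IVar list_len) (NGet csr_val (IVar csr_cursor)))
    (Seq (ISet list_len (IAdd (IVar list_len) (ICst 1)))
         (ISet csr_cursor (IAdd (IVar csr_cursor) (ICst 1)))))).

Definition csr_lister : cmd :=
  Seq (ISet list_len (ICst 0))
  (Seq (ISet csr_cursor (IGet csr_ptr (IVar row_reg))) csr_loop).

Lemma csr_loopP (K : numFieldType) (d : nat) (s : state K) :
  iarr s csr_ptr (ivar s row_reg + 1)%N = (ivar s csr_cursor + d)%N ->
  exists t s', [/\ exec csr_loop s t s', (t <= 23 * d + 7)%N, agree false s s',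
    [/\ iarr s' csr_ptr =1 iarr s csr_ptr, iarr s' csr_col =1 iarr s csr_col
      & narr s' csr_val =1 narr s csr_val]
    & [/\ ivar s' list_len = (ivar s list_len + d)%N,
          forall k, (k < ivar s list_len)%N ->
            iarr s' list_col k = iarr s list_col k /\
            narr s' list_val k = narr s list_val k
        & forall k, (k < d)%N ->
            iarr s' list_col (ivar s list_len + k)%N =
              iarr s csr_col (ivar s csr_cursor + k)%N /\
            narr s' list_val (ivar s list_len + k)%N =
              narr s csr_val (ivar s csr_cursor + k)%N]].
Proof.
elim: d s => [|d IHd] s Hs.
  exists 7, s; split=> //; last by rewrite addn0.
  by apply: ExecWhileFalse; rewrite /= Hs addn0 leqnn.
pose s1 := set_iarr s list_col (ivar s list_len) (iarr s csr_col (ivar s csr_cursor)).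
pose s2 := set_narr s1 list_val (ivar s list_len) (narr s csr_val (ivar s csr_cursor)).
pose s3 := set_ivar s2 list_len (ivar s list_len + 1).
pose s4 := set_ivar s3 csr_cursor (ivar s csr_cursor + 1).
have Hs4 : iarr s4 csr_ptr (ivar s4 row_reg + 1)%N = (ivar s4 csr_cursor + d)%N.
  by rewrite /= {1}/upd /= Hs {1}/upd /= -addnA.
have [t [s' [E Ht ag [H1 H2 H3] [L1 L2 L3]]]] := IHd s4 Hs4.
eexists; exists s'; split.
- apply: ExecWhileTrue; last exact: E.
    by rewrite /= Hs -ltnNge addnS ltnS leq_addr.
  apply: ExecSeq; first exact: ExecIPut.
  apply: ExecSeq; first exact: ExecNPut.
  by apply: ExecSeq; exact: ExecISet.
- by change (23 + t <= 23 * d.+1 + 7)%N; rewrite mulnS -addnA leq_add2l.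
- by move=> k; have [] := ag k.
- by split=> k; rewrite (H1, H2, H3).
have len4 : ivar s4 list_len = (ivar s list_len).+1 by rewrite /= /upd /= addn1.
have cur4 : ivar s4 csr_cursor = (ivar s csr_cursor).+1 by rewrite /= /upd /= addn1.
split=> [|k kl|[|k]]; first by rewrite L1 len4 addnS.
- have [|-> ->] := L2 k; first by rewrite len4 ltnW.
  by rewrite /= /upd /= (ltn_eqF kl).
- move=> _; rewrite !addn0; have [|-> ->] := L2 (ivar s list_len).
    by rewrite len4.
  by rewrite /= /upd /= eqxx.
- by move=> kd; have := L3 k kd; rewrite len4 cur4 !addSnnS.
Qed.

Lemma csr_sparse_row_format (K : numFieldType) :
  sparse_row_format (@csr K) csr_lister.
Proof.
split=> [n A s s' ag H i|].
  have [_ _ ptrE valE] := ag 1%N; have [_ _ colE _] := ag 2%N.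
  have [le_pq pe vE] := H i; rewrite -!ptrE; split=> // [|k j kpq].
    by rewrite -(eq_map colE).
  by rewrite -colE -valE; exact: vE.
exists 23%N, 12%N => n A i s H rowE.
pose s1 := set_ivar s list_len 0.
pose s2 := set_ivar s1 csr_cursor (iarr s csr_ptr i).
have [le_pq pe vE] := H i.
pose d := (iarr s csr_ptr i.+1 - iarr s csr_ptr i)%N.
have [|t [s' [E Ht ag [H1 H2 H3] [L1 _ L3]]]] := @csr_loopP K d s2.
  by rewrite /= /upd /= rowE addn1 subnKC.
have dE : row_nnz A i = d.
  have := perm_size pe; rewrite !size_map size_iota size_filter -/d => ->.
  rewrite enumT /row_nnz cardE /enum_mem size_filter.
  by apply: eq_count => j; rewrite [LHS]inE.
have cE k : (k < d)%N -> iarr s' list_col k = iarr s csr_col (iarr s csr_ptr i + k)%N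
    /\ narr s' list_val k = narr s csr_val (iarr s csr_ptr i + k)%N.
  exact: L3.
exists (2 + (3 + t))%N, s'; split.
- apply: ExecSeq; first exact: (ExecISet s list_len (ICst 0)).
  apply: ExecSeq; last exact: E.
  have := ExecISet s1 csr_cursor (IGet csr_ptr (IVar row_reg)).
  by rewrite /= {1}/upd /= rowE.
- by rewrite dE (_ : 12 = 7 + 5)%N // addnA [leqRHS]addnA addnC leq_add2r.
- by move=> k; have [] := ag k.
- move=> i'; rewrite !H1; have [le' pe' vE'] := H i'; split=> //.
    by rewrite (eq_map H2).
  by move=> k j kpq; rewrite H2 H3; exact: vE'.
have lE : ivar s' list_len = d by rewrite L1.
split=> [|k j]; rewrite lE; last move=> kd.
  have -> // : mkseq (iarr s' list_col) d =
    [seq iarr s csr_col k | k <- iota (iarr s csr_ptr i) d].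
  rewrite -[X in iota X]addn0 iotaDl -map_comp; apply/eq_in_map => k.
  by rewrite mem_iota => /cE[].
have [-> ->] := cE k kd; apply: vE.
by rewrite leq_addr -ltn_subRL.
Qed.

(* Main.v *)
Require Import Defs.
From mathcomp Require Import all_boot all_order all_algebra.
From mathcomp Require Import complex.
From mathcomp Require Import all_classical all_reals all_analysis.
From mathcomp Require Import zify polyrcf.

Set Implicit Arguments.
Unset Strict Implicit.
Unset Printing Implicit Defensive.

Import Order.TTheory GRing.Theory Num.Theory.
Import numFieldNormedType.Exports ComplexField.Normc.

Local Open Scope ring_scope.

(* Both properties depend only on signs and on a reachability condition in
   the graph of the matrix (an edge i -> j for each nonzero a_ij): every row
   must reach a row whose sum is strictly dominant, i.e. less than 1 for a
   substochastic B, positive for a w.d.d. matrix A with nonnegative diagonal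
   and nonpositive off-diagonal entries.  If the condition holds, a minimum
   argument shows that A (or I - B) has a nonnegative inverse.  If it fails,
   the indicator x of the rows that reach no strict row contradicts
   convergence, as B x >= x, and contradicts A^-1 >= 0, as A x <= 0; that a
   nonsingular M-matrix A = sI - B has a nonnegative inverse is obtained by
   decreasing t from infinity to s in tI - B.

   The algorithm scans the rows once, recording the edges in linked lists of
   predecessors and enqueuing the strict rows, and then runs a breadth-first
   search backwards from these.  The search consumes each list as it goes, so
   that the number of rows not yet dequeued plus that of the unread edges
   decreases at each step. *)

(** * Reachability and nonnegative inverses *)

Definition reaches n (edge : rel 'I_n) (good : pred 'I_n) (i : 'I_n) : bool :=
  [exists j, connect edge i j && good j].

Lemma reaches_edge n (edge : rel 'I_n) good i j :
  edge i j -> reaches edge good j -> reaches edge good i.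
Proof.
move=> ij /existsP[k /andP[jk gk]]; apply/existsP; exists k.
by rewrite gk (connect_trans (connect1 ij) jk).
Qed.

(** Induction along a path: it can never leave [S]. *)
Lemma not_reaches_closed n (edge : rel 'I_n) good (S : pred 'I_n) i :
  (forall i j, S i -> edge i j -> S j) -> (forall i, S i -> ~~ good i) ->
  S i -> ~~ reaches edge good i.
Proof.
move=> clS badS Si; apply/existsP => -[j /andP[/connectP[p]]].
elim: p i Si => [i Si _ ->|k p IHp i Si /= /andP[ik kp]]; first exact/negP/badS.
by apply: IHp kp; exact: clS ik.
Qed.

(** Loops never help to reach a row, so edges are compared off the diagonal only. This allows
    passing from [B] to [1%:M - B], whose diagonals may have different zeros. *)
Lemma sub_reaches n (e e' : rel 'I_n) good i :
  (forall i j, i != j -> e i j -> e' i j) -> reaches e good i -> reaches e' good i.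
Proof.
move=> ee' /existsP[j /andP[ij gj]]; apply/existsP; exists j; rewrite gj andbT.
apply: connect_sub ij => k l kl; have [->|nkl] := eqVneq k l; first exact: connect0.
by apply/connect1/ee'.
Qed.

(** * Z-matrices and chained diagonal dominance *)

Section ZMatrices.
Variables (R : realFieldType) (n : nat).
Implicit Types (A B : 'M[R]_n).

Definition mx_nonneg A := forall i j, 0 <= A i j.

Definition Z_matrix A := forall i j, i != j -> A i j <= 0.

Definition strict_row A (i : 'I_n) := 0 < \sum_j A i j.

(** For a Z-matrix, nonnegative row sums force a nonnegative diagonal, and a row sum is then |a_ii|
    minus the sum of the other |a_ij|: this is weakly chained diagonal dominance without absolute
    values. *)
Definition chained_dominant A : Prop :=
  (forall i, 0 <= \sum_j A i j) /\
  forall i, reaches (fun i j => A i j != 0) (strict_row A) i.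

(* Where x is minimal and negative, both terms of
   (A x)_i = sum_j a_ij (x_j - x_i) + x_i sum_j a_ij are nonpositive, so the
   set of such rows contains no strict row and is closed under edges. *)
Lemma chained_dominant_monotone A (x : 'cV[R]_n) : Z_matrix A -> chained_dominant A ->
  (forall i, 0 <= (A *m x) i 0) -> forall i, 0 <= x i 0.
Proof.
move=> ZA [rowA reachA] Ax0 i0.
pose m := [arg min_(i < i0) x i 0]%O.
have minm j : x m 0 <= x j 0 by rewrite /m; case: arg_minP => // i _; exact.
apply: le_trans (minm i0); rewrite leNgt; apply/negP => m_lt0.
have key i : x i 0 = x m 0 -> ~~ strict_row A i /\
    forall j, A i j != 0 -> x j 0 = x m 0.
  move=> xi; have terms j : 0 <= A i j * (x i 0 - x j 0).
    have [->|ij] := eqVneq i j; first by rewrite subrr mulr0.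
    by rewrite mulr_le0 ?ZA // subr_le0 xi.
  have AxE : (A *m x) i 0 = x i 0 * (\sum_j A i j) - \sum_j A i j * (x i 0 - x j 0).
    rewrite mxE mulr_sumr -sumrB; apply: eq_bigr => j _.
    by rewrite mulrBr opprB addrCA [x i 0 * _]mulrC subrr addr0.
  have := Ax0 i; rewrite AxE subr_ge0 xi => le1.
  have le2 : x m 0 * (\sum_j A i j) <= 0 by rewrite mulr_le0_ge0 // ltW.
  have sum0 : \sum_j A i j * (x i 0 - x j 0) = 0.
    by apply/eqP; rewrite eq_le sumr_ge0 // andbT xi (le_trans le1).
  split; first by move: le1; rewrite -leNgt -xi sum0 xi nmulr_rge0.
  move=> j Aij.
  have /eqP := @psumr_eq0P _ _ xpredT _ (fun j _ => terms j) sum0 j isT.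
  by rewrite mulf_eq0 (negPf Aij) /= subr_eq0 xi => /eqP <-.
have := reachA m; apply/negP; apply: (@not_reaches_closed _ _ _ [pred i | x i 0 == x m 0]).
- by move=> i j /= /eqP/key[_ H] /H ->.
- by move=> i /= /eqP/key[].
- by rewrite /= eqxx.
Qed.

(** Monotonicity applies to a kernel vector and to its opposite, so the vector is zero. Transposes
    appear because [kermx] is a left kernel. *)
Lemma chained_dominant_unit A : Z_matrix A -> chained_dominant A -> A \in unitmx.
Proof.
move=> ZA dA; rewrite -unitmx_tr -row_free_unit -kermx_eq0; apply/eqP/row_matrixP => i.
rewrite row0; set u := row i _.
have uA : A *m u^T = 0.
  by apply: trmx_inj; rewrite trmx_mul trmxK trmx0; apply/sub_kermxP; exact: row_sub.
apply/rowP => j; rewrite mxE; apply/eqP; rewrite eq_le; apply/andP; split.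
  have := @chained_dominant_monotone A (- u^T) ZA dA _ j.
  by rewrite !mxE oppr_ge0; apply=> k; rewrite mulmxN uA oppr0 mxE.
have := @chained_dominant_monotone A u^T ZA dA _ j.
by rewrite !mxE; apply=> k; rewrite uA mxE.
Qed.

(** Column j of the inverse solves A x = e_j with e_j >= 0. *)
Lemma chained_dominant_inv A :
  Z_matrix A -> chained_dominant A -> mx_nonneg (invmx A).
Proof.
move=> ZA dA i j; have uA := chained_dominant_unit ZA dA.
have := @chained_dominant_monotone A (col j (invmx A)) ZA dA _ i.
rewrite mxE; apply => k; rewrite colE mulmxA mulmxV // mul1mx mxE.
exact: ler0n.
Qed.

Lemma strict_dominant A : (forall i, strict_row A i) -> chained_dominant A.
Proof.
move=> sA; split=> i; first exact/ltW/sA.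
by apply/existsP; exists i; rewrite connect0 sA.
Qed.

(* With x the indicator of the rows that reach no strict row, A x <= 0, hence
   x = A^-1 (A x) <= 0. *)
Lemma inv_nonneg_reaches A : Z_matrix A -> (forall i, 0 <= \sum_j A i j) ->
  A \in unitmx -> mx_nonneg (invmx A) -> chained_dominant A.
Proof.
move=> ZA rowA uA invA; split=> // i0; apply: contraT => bad0.
pose reach := reaches (fun i j => A i j != 0) (strict_row A).
pose x : 'cV[R]_n := \col_i (~~ reach i)%:R.
have Ax_le0 i : (A *m x) i 0 <= 0.
  rewrite mxE; have [ri|nri] := boolP (reach i).
    apply: sumr_le0 => j _; rewrite !mxE.
    have [rj|nrj] := boolP (reach j); first by rewrite mulr0.
    by rewrite mulr1 ZA //; apply: contraNneq nrj => <-.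
  (* The nonzero entries of a row that reaches no strict row lie in columns of the same kind, so (A
     x)_i is the full row sum. *)
  rewrite (eq_bigr (A i)) => [|j _].
    rewrite leNgt; apply: contra nri => si.
    by apply/existsP; exists i; rewrite connect0 //; exact: si.
  rewrite mxE; have [rj|_] := boolP (reach j); last by rewrite mulr1.
  have [->|Aij] := eqVneq (A i j) 0; first by rewrite mul0r.
  by case/negP: nri; exact: (@reaches_edge _ (fun i j => A i j != 0) _ _ j).
have E : (invmx A *m (A *m x)) i0 0 = 1 by rewrite mulKmx // mxE bad0.
suff : (1 : R) <= 0 by rewrite ler10.
by rewrite -[X in X <= _]E mxE sumr_le0 // => j _; rewrite mulr_ge0_le0.
Qed.
End ZMatrices.

(** * Nonnegativity of the inverse of tI - B as t decreases *)

Section Positivity.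
Variables (R : realType) (n : nat).
Implicit Types (A B : 'M[R]_n).

(** Supplies one strict bound for all row sums, without a maximum over a possibly empty index
    set. *)
Lemma row_sum_lt_total A i : mx_nonneg A -> \sum_j A i j < 1 + \sum_k \sum_j A k j.
Proof.
move=> A0; rewrite [X in _ < _ + X](bigD1 i) //= addrCA ltrDl ltr_pwDl //.
by rewrite sumr_ge0 // => k _; exact: sumr_ge0.
Qed.

Lemma shift_row_sum A t i : \sum_j (t%:M - A) i j = t - \sum_j A i j.
Proof.
under eq_bigr do rewrite !mxE.
rewrite sumrB (bigD1 i) //= eqxx big1 ?addr0 // => j ji.
by rewrite eq_sym (negPf ji).
Qed.

Lemma shift_Z_matrix B t : mx_nonneg B -> Z_matrix (t%:M - B).
Proof. by move=> B0 i j ij; rewrite !mxE (negPf ij) sub0r oppr_le0. Qed.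

Lemma shift_inv_nonneg B t : mx_nonneg B -> (forall i, \sum_j B i j < t) ->
  mx_nonneg (invmx (t%:M - B)) /\ t%:M - B \in unitmx.
Proof.
move=> B0 Bt; have ZB := shift_Z_matrix t B0.
have dB : chained_dominant (t%:M - B).
  by apply: strict_dominant => i; rewrite /strict_row shift_row_sum subr_gt0.
by split; [exact: chained_dominant_inv|exact: chained_dominant_unit].
Qed.

(** With C the inverse at t and e = t - u, one has uI - B = (tI - B)(I - eC). Since c exceeds every
    row sum of C, for e < 1/c the rows of I - eC are strict, so its inverse D is nonnegative, and
    the inverse sought is DC. *)
Lemma inv_nonneg_left B t : t%:M - B \in unitmx -> mx_nonneg (invmx (t%:M - B)) ->
  exists2 d, 0 < d & forall u, t - d < u <= t -> mx_nonneg (invmx (u%:M - B)).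
Proof.
set C := invmx _ => uT C0.
pose c := 1 + \sum_i \sum_j C i j.
have sumC0 i : 0 <= \sum_j C i j by apply: sumr_ge0.
have c0 : 0 < c by rewrite ltr_pwDl // sumr_ge0.
exists c^-1; first by rewrite invr_gt0.
move=> u /andP[lt_u le_u].
pose e := t - u; have e0 : 0 <= e by rewrite subr_ge0.
have ec : e * c < 1 by rewrite -ltr_pdivlMr // mul1r /e ltrBlDl -ltrBlDr.
have eC0 : mx_nonneg (e *: C) by move=> i j; rewrite mxE mulr_ge0.
have [|D0 uD] := @shift_inv_nonneg (e *: C) 1 eC0.
  move=> i; apply: le_lt_trans ec; under eq_bigr do rewrite mxE.
  by rewrite -mulr_sumr ler_wpM2l // ltW ?row_sum_lt_total.
set D := invmx _ in D0.
have fact : u%:M - B = (t%:M - B) *m (1%:M - e *: C).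
  rewrite mulmxBr mulmx1 -scalemxAr mulmxV // scalemx1 addrAC.
  by rewrite -(raddfB (@scalar_mx R n)) /e subKr.
have invE : (D *m C) *m (u%:M - B) = 1%:M.
  by rewrite fact -mulmxA (mulmxA C) mulVmx // mul1mx mulVmx.
have [_ uU] := mulmx1_unit invE.
have -> : invmx (u%:M - B) = D *m C by rewrite -[RHS](mulmxK uU) invE mul1mx.
by move=> i j; rewrite mxE sumr_ge0 // => k _; rewrite mulr_ge0.
Qed.

Lemma horner_ge0_right (p : {poly R}) t :
  (forall u, t < u -> 0 <= p.[u]) -> 0 <= p.[t].
Proof.
move=> p0; rewrite leNgt; apply/negP => pt.
have [|d d0 near] := @poly_cont R t p (- p.[t]); first by rewrite oppr_gt0.
have lt_t : t < t + d / 2 by rewrite ltrDl divr_gt0.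
have := near (t + d / 2); rewrite addrAC subrr add0r gtr0_norm ?divr_gt0 //.
rewrite ltr_pdivrMr // ltr_pMr // ltr1n => /(_ isT).
rewrite ltr_norml => /andP[_]; rewrite ltrBlDr addNr ltNge.
by rewrite p0.
Qed.

(** An entry of the inverse has the sign of adjugate entry times determinant, which is a polynomial
    in u; nonnegativity therefore passes to the limit. *)
Lemma inv_nonneg_right_limit B t :
  (forall u, t <= u -> u%:M - B \in unitmx) ->
  (forall u, t < u -> mx_nonneg (invmx (u%:M - B))) ->
  mx_nonneg (invmx (t%:M - B)).
Proof.
move=> uB invB i j.
pose p := (\adj (char_poly_mx B)) i j * char_poly B.
have pE u : p.[u] = (\adj (u%:M - B)) i j * \det (u%:M - B).
  have mapE : map_mx (horner_eval u) (char_poly_mx B) = u%:M - B.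
    apply/matrixP => k l; rewrite !mxE /horner_eval hornerD hornerN hornerC.
    by rewrite hornerMn hornerX.
  rewrite /p hornerM /char_poly -mapE det_map_mx -map_mx_adj.
  by congr (_ * _); rewrite [RHS]mxE.
have invE u : t <= u -> (0 <= invmx (u%:M - B) i j) = (0 <= p.[u]).
  move=> tu; have uU := uB u tu; have := uU; rewrite unitmxE unitfE => det0.
  rewrite pE /invmx uU mxE; set d := \det _; set a := (\adj _) i j.
  have -> : d^-1 * a = a * d * d^-1 ^+ 2 by rewrite expr2 mulrA mulfK // mulrC.
  by rewrite pmulr_lge0 // exprn_even_gt0 //= invr_eq0.
rewrite invE //; apply: horner_ge0_right => u tu.
by rewrite -(invE u (ltW tu)); exact: invB tu _ _.
Qed.

(** Let T be the infimum of the thresholds t >= s from which on the inverse is nonnegative. The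
    right limit gives nonnegativity at T, and the left neighbourhood extends it below T, so T cannot
    stay away from s. *)
Lemma shift_inv_nonneg_from B s : mx_nonneg B ->
  (forall t, s <= t -> t%:M - B \in unitmx) -> mx_nonneg (invmx (s%:M - B)).
Proof.
move=> B0 uB.
pose S : set R := [set t | s <= t /\ forall u, t <= u -> mx_nonneg (invmx (u%:M - B))]%classic.
have S0 : (S !=set0)%classic.
  (* [b] exceeds every row sum of [B], so [u%:M - B] has only strict rows for u >= b. *)
  pose b := 1 + \sum_i \sum_j B i j; exists (Num.max s b); split.
    by rewrite le_max lexx.
  move=> u; rewrite ge_max => /andP[_ bu]; apply: (shift_inv_nonneg B0 _).1 => i.
  by apply: lt_le_trans bu; exact: row_sum_lt_total.
have lbS : lbound S s by move=> t [].
pose T := inf S.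
have sT : s <= T by exact: lb_le_inf.
have right u : T < u -> mx_nonneg (invmx (u%:M - B)).
  move=> Tu; have [|t [_ tP] tu] := @inf_adherent _ S (u - T) _ (conj S0 (ex_intro _ s lbS)).
  - by rewrite subr_gt0.
  - by apply: tP; move: tu; rewrite addrC subrK => /ltW.
have atT : mx_nonneg (invmx (T%:M - B)).
  by apply: inv_nonneg_right_limit right => u Tu; apply: uB; exact: le_trans Tu.
have [d d0 left] := inv_nonneg_left (uB _ sT) atT.
have invTd u : T - d < u -> mx_nonneg (invmx (u%:M - B)).
  by move=> lu; case: (leP u T) => [uT|/right //]; apply: left; rewrite lu.
apply: (invTd s); rewrite ltrBlDr -ltrBlDl; case: (leP d (T - s)) => // dTs.
(* Half of [d], since nonnegativity is known only strictly above [T - d]. *)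
have : S (T - d / 2).
  split.
    rewrite lerBrDr -lerBrDl; apply: le_trans dTs.
    by rewrite ler_pdivrMr // ler_pMr // ler1n.
  move=> u lu; apply: (invTd u); apply: lt_le_trans lu.
  by rewrite ltrD2l ltrN2 ltr_pdivrMr // ltr_pMr // ltr1n.
by move=> /(ge_inf (ex_intro _ s lbS)); rewrite -/T lerBrDr gerDl leNgt divr_gt0.
Qed.
End Positivity.

(** * The criteria *)

Section Convergence.
Local Open Scope classical_set_scope.
Variables (R : realType) (n : nat).
Implicit Types B : 'M[R]_n.

(** Neighbourhoods of a matrix are generated by boxes of neighbourhoods of its finitely many
    entries. *)
Lemma convergentP B :
  convergent B <-> forall i j, (fun k => (B ^+ k) i j) @ \oo --> (0 : R).
Proof.
split=> [cvB i j A A0|cvB A [P P0 sub]].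
  have := cvB [set M : 'M[R]_n | A (M i j)]; apply.
  exists (fun i' j' => if (i' == i) && (j' == j) then A else setT) => [i' j'|M /= AM].
    rewrite mxE; case: ifP => _ //; exact: filterT.
  by have := AM i j; rewrite !eqxx.
have near : \forall k \near \oo, forall i j, P i j ((B ^+ k) i j).
  apply: filter_forall => i; apply: filter_forall => j.
  by apply: cvB; have := P0 i j; rewrite mxE.
by apply: filterS near => k /= Pk; exact: sub.
Qed.

Lemma expmx_nonneg B k : mx_nonneg B -> mx_nonneg (B ^+ k).
Proof.
move=> B0; elim: k => [|k IHk] i j; first by rewrite expr0 mxE ler0n.
by rewrite exprS mxE sumr_ge0 // => l _; rewrite mulr_ge0.
Qed.

(** The partial sums of the Neumann series equal N - N B^k, hence are bounded entrywise by N. A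
    bounded series of nonnegative terms converges, so its terms vanish. *)
Lemma powers_vanish B : mx_nonneg B -> 1%:M - B \in unitmx ->
  mx_nonneg (invmx (1%:M - B)) -> convergent B.
Proof.
move=> B0 uM N0; apply/convergentP => i j.
set N := invmx _ in N0.
have partialE k : \sum_(l < k) B ^+ l = N - N *m B ^+ k.
  have geo : (1%:M - B) *m (\sum_(l < k) B ^+ l) = 1%:M - B ^+ k.
    by apply: oppr_inj; rewrite -mulNmx !opprB; exact/esym/subrX1.
  by rewrite -[LHS](mulKmx uM) geo mulmxBr mulmx1.
apply: cvg_series_cvg_0; apply: nondecreasing_is_cvgn.
  by apply: nondecreasing_series => k _ _; exact: expmx_nonneg.
exists (N i j) => _ [k _ <-]; rewrite /series /=.
have := congr1 (fun M : 'M[R]_n => M i j) (partialE k).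
rewrite -(big_mkord xpredT (fun l => B ^+ l)) /= summxE => ->.
rewrite !mxE gerBl sumr_ge0 // => l _.
by rewrite mulr_ge0 //; exact: expmx_nonneg.
Qed.

(* If x is the indicator of the rows that reach no row of sum less than 1,
   then B x >= x, hence B^k x >= x. *)
Lemma convergent_reaches B : substochastic B -> convergent B ->
  forall i, reaches (fun i j => B i j != 0) (fun i => ~~ (1 <= \sum_j B i j)) i.
Proof.
move=> [B0 B1] cvB i0; apply: contraT => bad0.
pose reach := reaches (fun i j => B i j != 0) (fun i => ~~ (1 <= \sum_j B i j)).
pose x : 'cV[R]_n := \col_i (~~ reach i)%:R.
have Bx i : x i 0 <= (B *m x) i 0.
  rewrite [in leLHS]mxE; have [ri|nri] := boolP (reach i).
    by rewrite mxE sumr_ge0 // => j _; rewrite !mxE mulr_ge0.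
  rewrite mxE (eq_bigr (B i)) => [|j _].
    by apply: contraNT nri => lt1; apply/existsP; exists i; rewrite connect0.
  rewrite mxE; have [rj|_] := boolP (reach j); last by rewrite mulr1.
  have [->|Bij] := eqVneq (B i j) 0; first by rewrite mul0r.
  by case/negP: nri; exact: (@reaches_edge _ (fun i j => B i j != 0) _ _ j).
have Bkx k i : x i 0 <= (B ^+ k *m x) i 0.
  elim: k i => [|k IHk] i; first by rewrite expr0 mul1mx.
  rewrite exprS -[B * _]/(B *m _) -mulmxA; apply: le_trans (Bx i) _.
  by rewrite !mxE ler_sum // => j _; rewrite ler_wpM2l.
have cvS : (fun k => \sum_j (B ^+ k) i0 j) @ \oo --> (0 : R).
  have sum0 : \sum_(j : 'I_n) (0 : R) = 0 by rewrite big1.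
  rewrite -[X in _ --> X]sum0; apply: cvg_big => [|j _]; last exact: (convergentP B).1.
  exact: add_continuous.
(* Row sum [i0] of B^k is at least (B^k x)_i0 >= x_i0 = 1, yet it tends to 0. *)
have : (1 : R) <= 0.
  rewrite -(cvg_lim _ cvS) //; apply: limr_ge; first exact/cvgP/cvS.
  apply: nearW => k; have := Bkx k i0; rewrite [in leLHS]mxE bad0 => /le_trans; apply.
  rewrite mxE ler_sum // => j _; rewrite mxE.
  by case: (reach j); rewrite ?mulr0 ?mulr1 // expmx_nonneg.
by rewrite ler10.
Qed.

(** I - B is a Z-matrix with row sums 1 minus those of B, so its strict rows are the rows of B with
    sum below 1, and it is chained dominant. *)
Lemma reaches_convergent B : substochastic B ->
  (forall i, reaches (fun i j => B i j != 0) (fun i => ~~ (1 <= \sum_j B i j)) i) ->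
  convergent B.
Proof.
move=> [B0 B1] reachB; have ZB := shift_Z_matrix 1 B0.
have dB : chained_dominant (1%:M - B).
  split=> i; first by rewrite shift_row_sum subr_ge0.
  have -> : strict_row (1%:M - B) = (fun i => ~~ (1 <= \sum_j B i j)).
    by apply: funext => k; rewrite /strict_row shift_row_sum subr_gt0 ltNge.
  apply: sub_reaches (reachB i) => k l kl.
  by rewrite !mxE (negPf kl) sub0r oppr_eq0.
apply: powers_vanish => //; first exact: chained_dominant_unit.
exact: chained_dominant_inv.
Qed.
End Convergence.

(** * Nonsingular M-matrices among w.d.d. matrices *)

Section MMatrices.
Variables (R : realType) (n : nat).
Implicit Types (B M : 'M[R]_n) (A : 'M[R[i]]_n).
Local Notation C_of := (real_complex R).

(** Eigenvectors are row vectors, v B = l v, so row sums control the l^1 norm: |l| |v| <= sum_i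
    |v_i| sum_j b_ij <= c |v|. *)
Lemma eigenvalue_norm_le B c l : mx_nonneg B -> (forall i, \sum_j B i j <= c) ->
  eigenvalue (map_mx C_of B) l -> normc l <= c.
Proof.
move=> B0 Bc /eigenvalueP[v vB v0].
have vS : 0 < \sum_j `|v 0 j|.
  rewrite lt_def sumr_ge0 ?andbT //; apply: contra v0 => /eqP S0.
  apply/eqP/rowP => j; rewrite mxE; apply/eqP; rewrite -normr_eq0; apply/eqP.
  exact: (@psumr_eq0P _ _ xpredT (fun j => `|v 0 j|) (fun j _ => normr_ge0 _) S0 j isT).
have : `|l| * \sum_j `|v 0 j| <= C_of c * \sum_j `|v 0 j|.
  rewrite mulr_sumr (eq_bigr (fun j => `|\sum_i v 0 i * C_of (B i j)|)); last first.
    move=> j _; have := congr1 (fun w : 'rV__ => w 0 j) vB; rewrite !mxE => vBj.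
    rewrite -normrM -vBj; congr `|_|; by apply: eq_bigr => k _; rewrite mxE.
  apply: (@le_trans _ _ (\sum_j \sum_i `|v 0 i| * C_of (B i j))).
    apply: ler_sum => j _; apply: le_trans (ler_norm_sum _ _ _) _.
    apply: ler_sum => i _; rewrite normrM [X in _ * X]ger0_norm //.
    by rewrite ler0c.
  rewrite exchange_big mulr_sumr /=; apply: ler_sum => i _.
  by rewrite -mulr_sumr mulrC ler_wpM2r // -rmorph_sum lecR.
by rewrite ler_pM2r // -lecR.
Qed.

Lemma eigenvalue_le_spectral_radius B l : mx_nonneg B ->
  eigenvalue (map_mx C_of B) l -> normc l <= spectral_radius B.
Proof.
move=> B0 Bl; apply: ub_le_sup; last by exists l.
exists (1 + \sum_k \sum_j B k j) => _ [k Bk <-].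
by apply: eigenvalue_norm_le Bk => // i; exact/ltW/row_sum_lt_total.
Qed.

Lemma spectral_radius_le B c : mx_nonneg B -> 0 <= c ->
  (forall i, \sum_j B i j <= c) -> spectral_radius B <= c.
Proof.
move=> B0 c0 Bc; rewrite /spectral_radius; set E := (X in sup X).
(* The [sup] of an empty set is 0 by default; [0 <= c] covers this case. *)
have [->|/set0P E0] := eqVneq E set0; first by rewrite sup0.
by apply: ge_sup => // _ [l Bl <-]; exact: eigenvalue_norm_le Bl.
Qed.

(** If tI - B were singular for some t > s, then t would be an eigenvalue beyond the spectral
    radius. *)
Lemma shift_unit_right B s t : mx_nonneg B -> spectral_radius B <= s ->
  s%:M - B \in unitmx -> s <= t -> t%:M - B \in unitmx.
Proof.
move=> B0 Bs uM; rewrite le_eqVlt => /predU1P[<- //|st].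
apply: contraT => nuM.
have Bt : eigenvalue (map_mx C_of B) (C_of t).
  rewrite /eigenvalue /eigenspace -map_scalar_mx -map_mxB kermx_eq0 row_free_unit.
  by rewrite map_unitmx -opprB -scaleN1r unitmxZ ?unitrN1.
have := eigenvalue_le_spectral_radius B0 Bt.
rewrite leNgt; suff -> : spectral_radius B < normc (C_of t) by [].
apply: le_lt_trans Bs (lt_le_trans st _).
by rewrite /= expr0n addr0 sqrtr_sqr ler_norm.
Qed.

Lemma wdd_row_sum M : Z_matrix M -> (forall i, 0 <= M i i) ->
  wdd (map_mx C_of M) <-> forall i, 0 <= \sum_j M i j.
Proof.
move=> ZM dM.
suff rowE i : (\sum_(j | j != i) `|map_mx C_of M i j| <= `|map_mx C_of M i i|)
    = (0 <= \sum_j M i j).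
  by split=> H i; [rewrite -rowE; exact: H|rewrite rowE; exact: H].
rewrite mxE ger0_norm ?ler0c // (eq_bigr (fun j => C_of (- M i j))).
  by rewrite -rmorph_sum lecR sumrN -subr_ge0 opprK [in RHS](bigD1 i).
move=> j ji; rewrite mxE -normrN -rmorphN ger0_norm // ler0c oppr_ge0 ZM //.
by rewrite eq_sym.
Qed.

(** In 1 = sum_j m_ij n_ji, with N the inverse, the terms with j != i are nonpositive, so m_ii n_ii
    >= 1. *)
Lemma inv_nonneg_diag_gt0 M i : Z_matrix M -> M \in unitmx ->
  mx_nonneg (invmx M) -> 0 < M i i.
Proof.
move=> ZM uM N0; have := congr1 (fun X : 'M[_]_n => X i i) (mulmxV uM).
rewrite /= !mxE eqxx (bigD1 i) //= => E.
have le0 : \sum_(j | j != i) M i j * invmx M j i <= 0.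
  by apply: sumr_le0 => j ji; rewrite mulr_le0_ge0 // ZM // eq_sym.
rewrite ltNge; apply/negP => Mi.
have : (1 : R) <= 0 by rewrite -[X in X <= _]E -[0 in leRHS]addr0 lerD // mulr_le0_ge0.
by rewrite ler10.
Qed.

(** Forwards, the inverse is nonnegative, hence the diagonal is positive; weak dominance then reads
    as nonnegative row sums, and reachability follows. *)
Lemma nonsingular_M_matrix_real M : wdd (map_mx C_of M) ->
  nonsingular_M_matrix (map_mx C_of M) <->
  [/\ Z_matrix M, forall i, 0 <= M i i & chained_dominant M].
Proof.
move=> dA; split=> [[[s [B [B0 Bs AE]]] uA]|[ZM dM cM]].
  have ME : M = s%:M - B.
    apply/matrixP => i j; have := congr1 (fun X : 'M[_]_n => X i j) AE.
    by rewrite !mxE => /complexI.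
  have uM : M \in unitmx by move: uA; rewrite map_unitmx.
  have ZM : Z_matrix M by rewrite ME; exact: shift_Z_matrix.
  have N0 : mx_nonneg (invmx M).
    rewrite ME; apply: shift_inv_nonneg_from => // t.
    by apply: shift_unit_right => //; rewrite -ME.
  have dM i : 0 <= M i i by apply/ltW/inv_nonneg_diag_gt0.
  split=> //; apply: inv_nonneg_reaches => //.
  exact/wdd_row_sum.
split; last by rewrite map_unitmx chained_dominant_unit.
(* The trace majorizes each diagonal entry, so sI - M is nonnegative; its row sums are at most s,
   which bounds the spectral radius. *)
pose s := \sum_k M k k; exists s, (s%:M - M).
have B0 : mx_nonneg (s%:M - M).
  move=> i j; rewrite !mxE; have [<-|ij] := eqVneq i j.
    by rewrite /s (bigD1 i) //= addrC addKr sumr_ge0.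
  by rewrite sub0r oppr_ge0 ZM.
split=> //; last by rewrite subKr.
apply: spectral_radius_le => // [|i]; first exact: sumr_ge0.
by rewrite shift_row_sum gerBl; case: cM => ->.
Qed.

(** In the partial order of [R[i]] either comparison also forces [x] to be real. *)
Definition L_sign (diag : bool) (x : R[i]) : bool := if diag then 0 <= x else x <= 0.

Lemma nonsingular_M_matrixP A : wdd A -> nonsingular_M_matrix A <->
  (forall i j, A i j != 0 -> L_sign (i == j) (A i j)) /\
  (forall i, reaches (fun i j => A i j != 0) (fun i => ~~ (\sum_j A i j <= 0)) i).
Proof.
move=> dA.
have critE M : A = map_mx C_of M ->
    (forall i j, A i j != 0 -> L_sign (i == j) (A i j)) <->
    Z_matrix M /\ forall i, 0 <= M i i.
  move=> ->; split=> [sA|[ZM dM] i j _]; last first.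
    by rewrite /L_sign mxE; case: eqVneq => [<-|ij]; rewrite ?ler0c // lecR ZM.
  split=> [i j ij|i].
    have [->//|Mij] := eqVneq (M i j) 0.
    by have := sA i j; rewrite mxE fmorph_eq0 => /(_ Mij); rewrite /L_sign (negPf ij) lecR.
  have [->//|Mij] := eqVneq (M i i) 0.
  by have := sA i i; rewrite mxE fmorph_eq0 => /(_ Mij); rewrite /L_sign eqxx ler0c.
have reachE M : A = map_mx C_of M -> forall i,
    reaches (fun i j => A i j != 0) (fun i => ~~ (\sum_j A i j <= 0)) i =
    reaches (fun i j => M i j != 0) (strict_row M) i.
  move=> AE i; congr (reaches _ _ i).
    by apply/funext => k; apply/funext => j; rewrite AE mxE fmorph_eq0.
  apply/funext => k; rewrite /strict_row ltNge -lecR rmorph_sum AE.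
  by congr (~~ (_ <= _)); apply: eq_bigr => j _; rewrite mxE.
split=> [MA|[sA rA]].
  have [[s [B [_ _ AE]]] _] := MA; have := MA; rewrite AE.
  rewrite nonsingular_M_matrix_real -?AE // => -[ZM dM [_ rM]].
  split; first by apply/(critE _ AE).
  by move=> i; rewrite (reachE _ AE).
(* The sign condition makes every entry real, so the real case applies to the real part of [A]. *)
have AE : A = map_mx C_of (map_mx (@complex.Re R) A).
  apply/matrixP => i j; rewrite !mxE RRe_real //.
  have [->|/sA] := eqVneq (A i j) 0; first exact: real0.
  by rewrite /L_sign; case: ifP => _; [exact: ger0_real|exact: ler0_real].
have [ZM dM] := (critE _ AE).1 sA.
rewrite AE nonsingular_M_matrix_real -?AE //; split=> //; split=> i.
  by apply: (wdd_row_sum ZM dM).1; rewrite -AE.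
by rewrite -(reachE _ AE).
Qed.
End MMatrices.

(** * Running time of programs *)

Section Runs.
Variable K : numFieldType.
Implicit Types (s : state K) (c : cmd).

(** A total-correctness triple with a time bound; [decides_within] is an instance. *)
Definition runs c s T (Q : state K -> Prop) : Prop :=
  exists t s', [/\ exec c s t s', (t <= T)%N & Q s'].

Lemma runs_weaken c s T T' (Q Q' : state K -> Prop) :
  runs c s T Q -> (T <= T')%N -> (forall s', Q s' -> Q' s') -> runs c s T' Q'.
Proof.
move=> [t [s' [E le_t Qs]]] leT QQ'; exists t, s'; split=> //; last exact: QQ'.
exact: leq_trans leT.
Qed.

Lemma runs_seq c1 c2 s T1 T2 Q :
  runs c1 s T1 (fun s' => runs c2 s' T2 Q) -> runs (Seq c1 c2) s (T1 + T2) Q.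
Proof.
move=> [t1 [s1 [E1 le1 [t2 [s2 [E2 le2 Qs]]]]]].
by exists (t1 + t2)%N, s2; split=> //; [exact: ExecSeq E2|exact: leq_add].
Qed.

(** The index of the invariant is a variant, so the body runs at most m times; the last [bcost e]
    pays for the failing test. *)
Lemma runs_while (I : nat -> state K -> Prop) e c T :
  (forall m s, I m s -> bval s e ->
     runs c s T (fun s' => exists2 m', (m' < m)%N & I m' s')) ->
  forall m s, I m s ->
  runs (While e c) s (m * (bcost e + T) + bcost e)
    (fun s' => ~~ bval s' e /\ exists m', I m' s').
Proof.
move=> body; elim/ltn_ind => m IHm s Is.
have [es|es] := boolP (bval s e); last first.
  by exists (bcost e), s; split; [exact: ExecWhileFalse|lia|split=> //; exists m].
have [t1 [s1 [E1 le1 [m' lt_m' Is1]]]] := body _ _ Is es.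
have [t2 [s2 [E2 le2 Qs]]] := IHm _ lt_m' _ Is1.
exists (bcost e + t1 + t2)%N, s2; split=> //; first exact: ExecWhileTrue E2.
have : (m'.+1 * (bcost e + T) <= m * (bcost e + T))%N by rewrite leq_mul2r lt_m' orbT.
by rewrite mulSn; lia.
Qed.

(* Loop-free commands that leave the input names intact. *)
Fixpoint straight c : bool :=
  match c with
  | Skip => true
  | ISet x _ | NSet x _ | IPut x _ _ | NPut x _ _ => ~~ x.1
  | Seq p q | If _ p q => straight p && straight q
  | While _ _ => false
  end.

(** Computes the final state of loop-free commands by simplification. The [While] cases here and in
    [max_cost] are placeholders, excluded by [straight]. *)
Fixpoint effect c s : state K :=
  match c with
  | ISet x e => set_ivar s x (ival s e)
  | NSet x e => set_nvar s x (nval s e)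
  | IPut a e1 e2 => set_iarr s a (ival s e1) (ival s e2)
  | NPut a e1 e2 => set_narr s a (ival s e1) (nval s e2)
  | Seq p q => effect q (effect p s)
  | If e p q => if bval s e then effect p s else effect q s
  | Skip | While _ _ => s
  end.

Fixpoint max_cost c : nat :=
  match c with
  | ISet _ e => (icost e).+1
  | NSet _ e => (ncost e).+1
  | IPut _ e1 e2 => (icost e1 + icost e2).+1
  | NPut _ e1 e2 => (icost e1 + ncost e2).+1
  | Seq p q => max_cost p + max_cost q
  | If e p q => bcost e + maxn (max_cost p) (max_cost q)
  | Skip | While _ _ => 1
  end.

Lemma agree_trans b s1 s2 s3 : agree b s1 s2 -> agree b s2 s3 -> agree b s1 s3.
Proof.
move=> H1 H2 k; have [-> -> E1 E2] := H1 k; have [-> -> E3 E4] := H2 k.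
by split=> // i; rewrite ?E1 ?E2.
Qed.

Lemma agree_straight c s : straight c -> agree true s (effect c s).
Proof.
have neq k (x : name) : ~~ x.1 -> ((true, k) == x) = false.
  by case: x => -[] // ? _; apply/eqP.
elim: c s => [|x e|x e|x e1 e2|x e1 e2|p IHp q IHq|e p IHp q IHq|] //= s.
- by move=> Hx k; split; rewrite //= /upd neq.
- by move=> Hx k; split; rewrite //= /upd neq.
- by move=> Hx k; split; rewrite //= /upd neq.
- by move=> Hx k; split; rewrite //= /upd neq.
- by case/andP=> Hp Hq; apply: agree_trans (IHp _ Hp) (IHq _ Hq).
- by case/andP=> Hp Hq; case: ifP => _; [exact: IHp|exact: IHq].
Qed.

(** The agreement handed to the postcondition carries the encoding of the matrix along the run. *)
Lemma runs_straight c s (Q : state K -> Prop) :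
  straight c -> (agree true s (effect c s) -> Q (effect c s)) ->
  runs c s (max_cost c) Q.
Proof.
move=> Hc HQ; have {HQ} := HQ (agree_straight s Hc).
elim: c s Q Hc => [|x e|x e|x e1 e2|x e1 e2|p IHp q IHq|e p IHp q IHq|] //= s Q.
- by move=> _ ?; exists 1%N, s; split=> //; exact: ExecSkip.
- by move=> _ HQ; do 2 eexists; split; [exact: ExecISet| |exact: HQ].
- by move=> _ HQ; do 2 eexists; split; [exact: ExecNSet| |exact: HQ].
- by move=> _ HQ; do 2 eexists; split; [exact: ExecIPut| |exact: HQ].
- by move=> _ HQ; do 2 eexists; split; [exact: ExecNPut| |exact: HQ].
- by case/andP=> Hp Hq HQ; apply/runs_seq/IHp => //; exact: IHq.
- case/andP=> Hp Hq; case: ifP => [es|/negbT es] HQ.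
    have [t [s' [E le_t Qs]]] := IHp _ _ Hp HQ.
    by exists (bcost e + t)%N, s'; split=> //; [exact: ExecIfTrue|lia].
  have [t [s' [E le_t Qs]]] := IHq _ _ Hq HQ.
  by exists (bcost e + t)%N, s'; split=> //; [exact: ExecIfFalse|lia].
Qed.

End Runs.

(** * The search *)

Definition col_reg : name := (false, 3%N).
Definition entry_reg : name := (false, 4%N).
Definition edge_count : name := (false, 5%N).
Definition sign_reg : name := (false, 6%N).
Definition queue_end : name := (false, 7%N).
Definition queue_start : name := (false, 8%N).
Definition edge_reg : name := (false, 9%N).
Definition src_reg : name := (false, 10%N).

Definition head_arr : name := (false, 0%N).
Definition next_arr : name := (false, 1%N).
Definition source_arr : name := (false, 2%N).
Definition queue_arr : name := (false, 3%N).
Definition visited_arr : name := (false, 4%N).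

Definition val_reg : name := (false, 0%N).
Definition sum_reg : name := (false, 1%N).

Definition incr (x : name) : cmd := ISet x (IAdd (IVar x) (ICst 1)).

Definition enqueue (x : name) : cmd :=
  Seq (IPut visited_arr (IVar x) (ICst 1))
  (Seq (IPut queue_arr (IVar queue_end) (IVar x))
       (incr queue_end)).

(** The nested loops of the search are flattened: a step either reads one edge into the front row
    or, if none is left, dequeues that row. *)
Definition search_step : cmd :=
  Seq (ISet col_reg (IGet queue_arr (IVar queue_start)))
  (Seq (ISet edge_reg (IGet head_arr (IVar col_reg)))
  (If (BIEq (IVar edge_reg) (ICst 0))
      (incr queue_start)
  (Seq (ISet src_reg (IGet source_arr (IVar edge_reg)))
  (Seq (IPut head_arr (IVar col_reg) (IGet next_arr (IVar edge_reg)))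
       (If (BIEq (IGet visited_arr (IVar src_reg)) (ICst 0))
           (enqueue src_reg) Skip))))).

Definition queue_nonempty : bexp :=
  BNot (BILe (IVar queue_end) (IVar queue_start)).

Definition search_cost : nat := bcost queue_nonempty + max_cost search_step.

Section Search.
Variables (K : numFieldType) (n : nat) (edge : rel 'I_n) (good : pred 'I_n).
Implicit Types (s : state K) (q : seq 'I_n) (adj : 'I_n -> seq 'I_n).

Local Notation reach := (reaches edge good).

(* The list of edges starting at h represents the rows l; edges are numbered
   from 1 to b, and 0 ends a list. *)
Fixpoint chain (nxt src : nat -> nat) (b h : nat) (l : seq 'I_n) : Prop :=
  match l with
  | [::] => h = 0%N
  | x :: l' => [/\ (0 < h <= b)%N, src h = x & chain nxt src b (nxt h) l']
  end.

Definition linked_lists adj s : Prop :=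
  forall j : 'I_n, chain (iarr s next_arr) (iarr s source_arr) (ivar s edge_count)
                         (iarr s head_arr j) (adj j).

Definition queued q s : Prop :=
  [/\ uniq q, ivar s queue_end = size q
    & forall k x, (k < size q)%N -> iarr s queue_arr k = nth x q k].

(** Memory is uninitialized, so during the scan only the marks of rows below [d] are meaningful. *)
Definition marked (d : nat) q s : Prop :=
  forall i : 'I_n, (i < d)%N -> iarr s visited_arr i = (i \in q).

(* The last clause: an edge out of a row not yet reached is still unread, and
   its end is still to be dequeued. *)
Definition search_inv (b m : nat) s : Prop :=
  exists q adj,
  [/\ [/\ linked_lists adj s, queued q s & marked n q s],
      (ivar s queue_start <= size q)%N,
      m = (n - ivar s queue_start + \sum_j size (adj j))%N,
      [/\ forall i j, i \in adj j -> edge i j,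
          forall i, i \in q -> reach i,
          forall i, good i -> i \in q
        & forall i j, edge i j -> i \notin q ->
            (i \in adj j) && (j \notin take (ivar s queue_start) q)]
    & ivar s order_reg = n /\ ivar s sign_reg = b].

Lemma queued_size q s : queued q s -> (size q <= n)%N.
Proof. by case=> uq _ _; rewrite -[n in leqRHS]card_ord -(card_uniqP uq) max_card. Qed.

Lemma search_stepP b m s :
  search_inv b m s ->
  bval s queue_nonempty ->
  exists2 m', (m' < m)%N & search_inv b m' (effect search_step s).
Proof.
move=> [q [adj [[ll qd mk] le_qs mE [adj_e q_r good_q e_q] [ordE signE]]]].
have le_qn := queued_size qd.
case: (qd) => uq qtE qE; rewrite /queue_nonempty /= qtE -ltnNge => lt_qs.
have lt_n := leq_trans lt_qs le_qn.
pose j0 := nth (Ordinal lt_n) q (ivar s queue_start).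
have jE := qE _ (Ordinal lt_n) lt_qs; rewrite -/j0 in jE.
have eq_e i j : edge i j -> i \notin q -> j != j0 ->
    j \notin take (ivar s queue_start).+1 q.
  move=> ij iq nj; have /andP[_] := e_q _ _ ij iq.
  by rewrite (take_nth (Ordinal lt_n) lt_qs) mem_rcons inE negb_or nj.
have := ll j0; rewrite /search_step /= /upd /= jE.
case adjE: (adj j0) => [|x l] /=.
  (* Dequeuing: edges out of rows not yet reached are unread, so none of them ends in [j0], whose
     list is empty. *)
  move=> ->; rewrite /=; eexists; last first.
    exists q, adj; split.
    - by split.
    - by rewrite /= /upd /= addn1.
    - by [].
    - split=> // i j ij iq; have /andP[ij_adj _] := e_q _ _ ij iq.
      rewrite ij_adj /= /upd /= addn1; apply: eq_e ij iq _.
      by apply: contraTneq ij_adj => ->; rewrite adjE.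
    - by [].
  by rewrite mE /= /upd /=; lia.
set h := iarr s head_arr j0 => -[h_in srcE chE].
have h0 : (h == 0%N) = false by lia.
rewrite h0 srcE.
pose adj' := upd adj j0 l.
have ll' : forall j : 'I_n, chain (iarr s next_arr) (iarr s source_arr)
    (ivar s edge_count) (upd (iarr s head_arr) j0 (iarr s next_arr h) j) (adj' j).
  by move=> j; rewrite /adj' /upd val_eqE; case: eqP => // _; exact: ll.
have size_adj' : (\sum_j size (adj j) = (\sum_j size (adj' j)).+1)%N.
  rewrite (bigD1 j0) // [in RHS](bigD1 j0) //= adjE.
  have -> : adj' j0 = l by rewrite /adj' /upd eqxx.
  rewrite addSn /adj'; congr (_ + _).+1.
  by apply: eq_bigr => j /negPf nj; rewrite /upd nj.
have adj'_e i j : i \in adj' j -> edge i j.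
  rewrite /adj' /upd; case: eqP => [->|_]; last exact: adj_e.
  by move=> il; apply: adj_e; rewrite adjE inE il orbT.
have x_j0 : edge x j0 by apply: adj_e; rewrite adjE mem_head.
(* Reading the edge from [x] to [j0] disturbs the last clause of the invariant only for edges out of
   [x], and [x] is in the queue after the step in either case. *)
have e_q' i j : edge i j -> i \notin q -> i != x ->
    (i \in adj' j) && (j \notin take (ivar s queue_start) q).
  move=> ij iq ix; have := e_q _ _ ij iq.
  by rewrite /adj' /upd; case: eqP => // ->; rewrite adjE inE (negPf ix).
have visE := mk x (ltn_ord x).
case: eqP => [|] visx; last first.
  have xq : x \in q by move: visx; rewrite visE; case: (x \in q).
  eexists; last first.
    exists q, adj'; split=> //.
    split=> // i j ij iq; apply: e_q' => //.
    by apply: contraNneq iq => ->.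
  by rewrite mE size_adj' /= /upd /= addnS ltnSn.
have xq : x \notin q by move: visx; rewrite visE; case: (x \in q).
eexists; last first.
  exists (rcons q x), adj'; split=> //.
  - split=> //.
    + split.
      * by rewrite rcons_uniq xq.
      * by rewrite /= /upd /= size_rcons qtE addn1.
      * move=> k y; rewrite size_rcons ltnS leq_eqVlt nth_rcons /= /upd /= qtE.
        by case: (ltngtP k (size q)) => //= lt_k _; exact: qE.
    + move=> i lt_i; rewrite mem_rcons inE /= /upd /= val_eqE.
      by case: (eqVneq i x) => //= _; exact: mk.
  - by rewrite size_rcons leqW.
  - split=> //.
    + move=> i; rewrite mem_rcons inE => /predU1P[->|]; last exact: q_r.
      by apply: reaches_edge x_j0 _; apply: q_r; exact: mem_nth.
    + by move=> i gi; rewrite mem_rcons inE good_q ?orbT.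
    + move=> i j ij; rewrite mem_rcons inE negb_or => /andP[ix iq].
      by rewrite /= /upd /= -cats1 takel_cat ?e_q'.
by rewrite mE size_adj' /= /upd /= addnS ltnSn.
Qed.

(** At exit all queued rows are dequeued, so no edge leads from outside the queue into it, and the
    queue consists of the rows that reach a good one. Having no repetition, it contains all rows
    exactly when its length is n. *)
Lemma searchP b m s : search_inv b m s ->
  runs (While queue_nonempty search_step) s (m.+1 * search_cost) (fun s' =>
    [/\ ivar s' order_reg = n, ivar s' sign_reg = b
      & (ivar s' queue_end == n) = [forall i, reach i]]).
Proof.
move=> inv_s; apply: runs_weaken (runs_while (T := max_cost search_step) _ inv_s) _ _.
- move=> {}m {}s {}inv_s es; apply: runs_straight => // _.
  exact: search_stepP inv_s es.
- by rewrite -/search_cost mulSnr leq_add2l leq_addr.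
move=> s' [done [m' [q [adj [[_ qd _] le_q _ [_ q_r good_q e_q] [ordE signE]]]]]].
have [uq qtE _] := qd; split=> //.
have qE i : (i \in q) = reach i.
  apply/idP/existsP => [/q_r/existsP //|[j /andP[ij /good_q jq]]].
  case/connectP: ij jq => p; elim: p i => [i _ -> //|x p IHp i /= /andP[ix xp] jE jq].
  have xq := IHp _ xp jE jq.
  apply/negPn/negP => /(e_q _ _ ix); rewrite take_oversize ?xq ?andbF //.
  by move: done; rewrite /= negbK qtE.
have -> : (ivar s' queue_end == n) = (#|q| == #|'I_n|).
  by rewrite qtE card_ord (card_uniqP uq).
apply/eqP/forallP => [qT i|all_r].
  by rewrite -qE (subset_cardP qT _ i) ?inE //; apply/fintype.subsetP.
by apply: eq_card => i; rewrite qE all_r.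
Qed.
End Search.

(** * Scanning the rows *)

(* How a program gets at the nonzero entries of the row [row_reg]: after
   running [fetch], the expression [len_exp] is their number, and [col_exp]
   and [val_exp] are the column and the value of the entry [entry_reg].
   Some zero entries may be listed as well. *)
Record row_reader := RowReader {
  fetch : cmd;
  len_exp : iexp;
  col_exp : iexp;
  val_exp : nexp
}.

(** The expressions must remain valid while the loop over the entries changes the memory of the
    algorithm, hence the quantification over [s']. *)
Definition reads_row (K : numFieldType) (rd : row_reader) (n : nat)
    (A : 'M[K]_n) (i : 'I_n) (cs : seq 'I_n) (s : state K) : Prop :=
  [/\ uniq cs, forall j, A i j != 0 -> j \in cs
    & forall s', agree true s s' ->
        ivar s' order_reg = n -> ivar s' row_reg = i ->
        ival s' (len_exp rd) = size cs /\
        forall j, (ivar s' entry_reg < size cs)%N ->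
          ival s' (col_exp rd) = nth j cs (ivar s' entry_reg) /\
          nval s' (val_exp rd) = A i (nth j cs (ivar s' entry_reg))].

Definition row_access (K : numFieldType) (rd : row_reader) (n : nat)
    (A : 'M[K]_n) (enc : state K -> Prop) (L r : nat) : Prop :=
  (forall s s', agree true s s' -> enc s -> enc s') /\
  forall (i : 'I_n) s, enc s -> ivar s order_reg = n -> ivar s row_reg = i ->
    runs (fetch rd) s L (fun s' => [/\ agree false s s', enc s'
      & exists2 cs : seq 'I_n, (size cs <= r)%N & reads_row rd A i cs s']).

Section Program.
Variables (rd : row_reader) (sign_test row_test : bexp).

(** The edge is prepended to the list of its end, as the search runs backwards. The counter is
    incremented first, which keeps 0 free to end lists. *)
Definition add_edge : cmd :=
  Seq (incr edge_count)
  (Seq (IPut next_arr (IVar edge_count) (IGet head_arr (IVar col_reg)))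
  (Seq (IPut source_arr (IVar edge_count) (IVar row_reg))
       (IPut head_arr (IVar col_reg) (IVar edge_count)))).

Definition entry_step : cmd :=
  Seq (NSet val_reg (val_exp rd))
  (Seq (ISet col_reg (col_exp rd))
  (Seq (NSet sum_reg (NAdd (NVar sum_reg) (NVar val_reg)))
  (Seq (incr entry_reg)
       (If (BNEq (NVar val_reg) (NCst 0)) Skip
           (Seq add_edge (If sign_test Skip (ISet sign_reg (ICst 0)))))))).

Definition more_entries : bexp := BNot (BILe (len_exp rd) (IVar entry_reg)).

Definition row_start : cmd :=
  Seq (ISet entry_reg (ICst 0)) (NSet sum_reg (NCst 0)).

Definition row_end : cmd :=
  Seq (If row_test (enqueue row_reg) (IPut visited_arr (IVar row_reg) (ICst 0)))
      (incr row_reg).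

Definition row_step : cmd :=
  Seq (fetch rd) (Seq row_start (Seq (While more_entries entry_step) row_end)).

Definition more_rows : bexp := BNot (BILe (IVar order_reg) (IVar row_reg)).

(** A row adds edges to the lists of arbitrary columns, so all heads must be cleared before the
    scan. *)
Definition clear_step : cmd :=
  Seq (IPut head_arr (IVar row_reg) (ICst 0)) (incr row_reg).

Definition init : cmd :=
  Seq (ISet row_reg (ICst 0)) (Seq (ISet edge_count (ICst 0))
  (Seq (ISet sign_reg (ICst 1)) (ISet queue_end (ICst 0)))).

Definition answer : cmd :=
  If (BAnd (BIEq (IVar sign_reg) (ICst 1)) (BIEq (IVar queue_end) (IVar order_reg)))
     (ISet answer_reg (ICst 1)) (ISet answer_reg (ICst 0)).

Definition program : cmd :=
  Seq (ISet row_reg (ICst 0))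
  (Seq (While more_rows clear_step)
  (Seq init
  (Seq (While more_rows row_step)
  (Seq (ISet queue_start (ICst 0))
  (Seq (While queue_nonempty search_step) answer))))).

(** New edges are stored beyond index [b], so older lists survive. *)
Lemma chain_mono n nxt src nxt' src' b b' h (l : seq 'I_n) :
  (b <= b')%N ->
  (forall k, (k <= b)%N -> nxt' k = nxt k /\ src' k = src k) ->
  chain nxt src b h l -> chain nxt' src' b' h l.
Proof.
move=> le_b eq_b; elim: l h => //= x l IHl h [/andP[h0 hb] srcE ch].
have [-> ->] := eq_b _ hb; split=> //; last exact: IHl.
by rewrite h0 (leq_trans hb).
Qed.

(** * Correctness and cost of the scan and of the whole program *)

Section Correctness.
Variables (K : numFieldType) (n : nat) (A : 'M[K]_n).
Variables (sign_ok : bool -> K -> bool) (row_ok : K -> bool).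
Hypothesis sign_testE : forall s : state K,
  bval s sign_test = sign_ok (ivar s row_reg == ivar s col_reg) (nvar s val_reg).
Hypothesis row_testE : forall s : state K, bval s row_test = row_ok (nvar s sum_reg).

Variables (enc : state K -> Prop) (L r : nat).
Hypothesis rd_ok : row_access rd A enc L r.

Implicit Types (s : state K) (q : seq 'I_n) (adj : 'I_n -> seq 'I_n).

Let edge (i j : 'I_n) := A i j != 0.
Let good (i : 'I_n) := row_ok (\sum_j A i j).

Definition signs_ok (P : rel 'I_n) : bool :=
  [forall i, forall j, P i j && edge i j ==> sign_ok (i == j) (A i j)].

(** [P] is the set of positions scanned so far; [c] bounds the number of edges, on which the time of
    the search depends. *)
Definition recorded (P : rel 'I_n) (c : nat) s : Prop :=
  exists adj, [/\ linked_lists adj s,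
    forall i j, (i \in adj j) = P i j && edge i j,
    (\sum_j size (adj j) <= c)%N & ivar s sign_reg = signs_ok P].

Definition scanned (i0 : 'I_n) (t : seq 'I_n) : rel 'I_n :=
  fun i j => (i < i0)%N || (i == i0) && (j \in t).

Definition entry_inv (i0 : 'I_n) (cs : seq 'I_n) q s0 m s : Prop :=
  let k := ivar s entry_reg in
  [/\ (k <= size cs)%N /\ m = (size cs - k)%N,
      [/\ agree true s0 s, ivar s order_reg = n & ivar s row_reg = i0],
      queued q s /\ marked i0 q s,
      nvar s sum_reg = \sum_(j <- take k cs) A i0 j
    & recorded (scanned i0 (take k cs)) (i0 * r + k) s].

Lemma eq_signs_ok P P' : (forall i j, edge i j -> P i j = P' i j) ->
  signs_ok P = signs_ok P'.
Proof.
move=> PP'; apply: eq_forallb => i; apply: eq_forallb => j.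
by have [ij|] := boolP (edge i j); rewrite ?andbF ?andbT // PP'.
Qed.

(** Positions of zero entries may be added or dropped: a listed zero leaves no trace, and unlisted
    ones count as scanned at the end of the row. *)
Lemma eq_recorded P P' c s : (forall i j, edge i j -> P i j = P' i j) ->
  recorded P c s -> recorded P' c s.
Proof.
move=> PP' [adj [ll adjE szE signE]]; exists adj; split=> //.
  by move=> i j; rewrite adjE; have [/PP'->|] := boolP (edge i j); rewrite ?andbF.
by rewrite signE (eq_signs_ok PP').
Qed.

Lemma signs_ok_add P P' i0 j0 : edge i0 j0 ->
  (forall i j, P' i j = P i j || (i == i0) && (j == j0)) ->
  signs_ok P' = signs_ok P && sign_ok (i0 == j0) (A i0 j0).
Proof.
move=> e0 P'E; apply/'forall_forallP/andP => [H|[/'forall_forallP H ok0] i j].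
  split; last by have := H i0 j0; rewrite P'E !eqxx orbT e0.
  by apply/'forall_forallP => i j; have := H i j; rewrite P'E; case: (P i j).
rewrite P'E; case: (boolP (_ && (j == j0))) => [/andP[/eqP-> /eqP->]|_].
  by rewrite ok0 implybT.
by rewrite orbF; exact: H.
Qed.

(** Equations on [s'] stand for the effect of [add_edge], so that both outcomes of the sign test are
    covered. *)
Lemma recorded_add P P' c i0 j0 s s' : edge i0 j0 ->
  (forall i j, P' i j = P i j || (i == i0) && (j == j0)) ->
  recorded P c s ->
  ivar s' edge_count = (ivar s edge_count).+1 ->
  iarr s' next_arr =
    upd (iarr s next_arr) (ivar s edge_count).+1 (iarr s head_arr j0) ->
  iarr s' source_arr = upd (iarr s source_arr) (ivar s edge_count).+1 (i0 : nat) ->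
  iarr s' head_arr = upd (iarr s head_arr) j0 (ivar s edge_count).+1 ->
  ivar s' sign_reg = (if sign_ok (i0 == j0) (A i0 j0) then ivar s sign_reg else 0%N) ->
  recorded P' c.+1 s'.
Proof.
move=> e0 P'E [adj [ll adjE szE signE]] cntE nextE sourceE headE sign'E.
exists (upd adj j0 (i0 :: adj j0)); split.
- move=> j; rewrite cntE nextE sourceE headE /upd val_eqE.
  have mono h l : chain (iarr s next_arr) (iarr s source_arr) (ivar s edge_count) h l ->
    chain (upd (iarr s next_arr) (ivar s edge_count).+1 (iarr s head_arr j0))
      (upd (iarr s source_arr) (ivar s edge_count).+1 (i0 : nat))
      (ivar s edge_count).+1 h l.
    by apply: chain_mono => // k le_k; rewrite /upd ltn_eqF.
  case: (eqVneq j j0) => [_|_]; last exact/mono/ll.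
  by rewrite /= eqxx ltnSn; split=> //; exact/mono/ll.
- move=> i j; rewrite P'E /upd; case: (eqVneq j j0) => [->|_].
    by rewrite inE adjE; case: eqP => [->|_]; rewrite ?e0 ?orbT ?orbF.
  by rewrite adjE andbF orbF.
- rewrite (bigD1 j0) //= {1}/upd eqxx /= addSn ltnS; apply: leq_trans szE.
  rewrite [leqRHS](bigD1 j0) //= leq_add2l leq_eqVlt; apply/orP; left; apply/eqP.
  by apply: eq_bigr => j /negPf nj; rewrite /upd nj.
- by rewrite sign'E signE (signs_ok_add e0 P'E); case: (signs_ok P); case: ifP.
Qed.

Lemma entry_stepP i0 cs q s0 m s :
  reads_row rd A i0 cs s0 -> entry_inv i0 cs q s0 m s -> bval s more_entries ->
  exists2 m', (m' < m)%N & entry_inv i0 cs q s0 m' (effect entry_step s).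
Proof.
move=> [_ _ rdP] [[le_k mE] [ag ordE rowE] [qd mk] sumE rec].
have [lenE entE] := rdP _ ag ordE rowE.
rewrite /more_entries /= lenE -ltnNge => lt_k.
have [_ valE] := entE i0 lt_k.
set k := ivar s entry_reg in le_k mE sumE rec lt_k valE.
pose j0 := nth i0 cs k; rewrite -/j0 in valE.
(* [col_exp] is evaluated after [val_reg] has been assigned, hence in this intermediate state. *)
have colE : ival (set_nvar s val_reg (A i0 j0)) (col_exp rd) = j0.
  by have [|//|//|_ /(_ i0 lt_k)[]] // := rdP (set_nvar s val_reg (A i0 j0)).
have agP : agree true s0 (effect entry_step s).
  by apply: agree_trans ag _; apply: agree_straight.
have takeE : take k.+1 cs = rcons (take k cs) j0 by rewrite (take_nth i0 lt_k).
have sumE' : nvar s sum_reg + nval s (val_exp rd) = \sum_(j <- take k.+1 cs) A i0 j.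
  by rewrite takeE -cats1 big_cat big_seq1 sumE valE.
exists (size cs - k.+1)%N; first by rewrite mE; lia.
have scE i j : scanned i0 (take k.+1 cs) i j =
    scanned i0 (take k cs) i j || (i == i0) && (j == j0).
  by rewrite /scanned takeE mem_rcons inE; case: (i < i0)%N; case: (i == i0);
     case: (j == j0); rewrite ?orbT ?orbF.
move: agP; rewrite /entry_step /= /upd /= valE colE.
case: eqP => [A0|/eqP nA0].
  move=> agP; rewrite /entry_inv /= /upd /= -/k addn1; split=> //.
  - by rewrite -valE.
  - have [adj [ll adjE szE signE]] := rec.
    apply: (@eq_recorded (scanned i0 (take k cs))).
      move=> i j; rewrite scE; case: (eqVneq i i0) => [->|_]; last by rewrite orbF.
      by case: eqP => [->|_]; rewrite ?orbF // /edge A0 eqxx.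
    by exists adj; split=> //; rewrite addnS ltnW.
rewrite sign_testE /= /upd /= rowE val_eqE -/k => agP.
case okE: (sign_ok _ _) agP => agP; rewrite /entry_inv /= /upd /= -/k addn1.
  split=> //; first by rewrite -valE.
  rewrite addnS; apply: (recorded_add nA0 scE rec); rewrite /= /upd //= ?addn1 //.
  by rewrite okE.
split=> //; first by rewrite -valE.
rewrite addnS; apply: (recorded_add nA0 scE rec); rewrite /= /upd //= ?addn1 //.
by rewrite okE.
Qed.

Definition entry_cost : nat := bcost more_entries + max_cost entry_step.

Lemma entriesP i0 cs q s0 m s :
  reads_row rd A i0 cs s0 -> entry_inv i0 cs q s0 m s ->
  runs (While more_entries entry_step) s (m.+1 * entry_cost)
    (fun s' => entry_inv i0 cs q s0 0 s').
Proof.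
move=> rdP inv_s; apply: runs_weaken (runs_while (T := max_cost entry_step) _ inv_s) _ _.
- move=> {}m {}s {}inv_s es; apply: runs_straight => // _.
  exact: entry_stepP inv_s es.
- by rewrite -/entry_cost mulSnr leq_add2l leq_addr.
move=> s' [done [m' [[le_k mE] ags qs sumE rec]]].
have [_ _ lenP] := rdP; have [ag ordE rowE] := ags.
have [lenE _] := lenP _ ag ordE rowE.
move: done; rewrite /more_entries /= lenE negbK => ge_k.
by split=> //; split=> //; apply/esym/eqP.
Qed.

Lemma agree_iarr b k s s' : agree b s s' -> iarr s (b, k) = iarr s' (b, k).
Proof. by move=> /(_ k)[_ _ E _]; apply: funext. Qed.

Lemma agree_ivar b k s s' : agree b s s' -> ivar s (b, k) = ivar s' (b, k).
Proof. by move=> /(_ k)[]. Qed.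

Lemma recorded_agree P c s s' : agree false s s' -> recorded P c s -> recorded P c s'.
Proof.
move=> ag [adj [ll adjE szE signE]]; exists adj; split=> //.
  move=> j; have := ll j.
  rewrite /head_arr /next_arr /source_arr /edge_count.
  by rewrite !(agree_iarr _ ag) !(agree_ivar _ ag).
by rewrite -signE /sign_reg (agree_ivar _ ag).
Qed.

Lemma queued_agree q s s' : agree false s s' -> queued q s -> queued q s'.
Proof.
move=> ag; rewrite /queued /queue_end /queue_arr.
by rewrite !(agree_iarr _ ag) !(agree_ivar _ ag).
Qed.

Lemma marked_agree d q s s' : agree false s s' -> marked d q s -> marked d q s'.
Proof. by move=> ag; rewrite /marked /visited_arr !(agree_iarr _ ag). Qed.

Definition row_inv m s : Prop :=
  let d := ivar s row_reg in
  exists q,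
  [/\ (d <= n)%N /\ m = (n - d)%N, ivar s order_reg = n /\ enc s,
      queued q s /\ marked d q s,
      recorded (fun i _ => i < d)%N (d * r) s
    & forall i : 'I_n, (i \in q) = (i < d)%N && good i].

Definition row_cost : nat :=
  max_cost row_start + (r.+1 * entry_cost + max_cost row_end).

Lemma row_stepP m s : row_inv m s -> bval s more_rows ->
  runs row_step s (L + row_cost) (fun s' => exists2 m', (m' < m)%N & row_inv m' s').
Proof.
move=> [q [[le_d mE] [ordE enc_s] [qd mk] rec qE]].
set d := ivar s row_reg in le_d mE mk rec qE.
rewrite /more_rows /= ordE -ltnNge -/d => lt_d.
pose i0 := Ordinal lt_d.
have [enc_agree /(_ i0 s enc_s ordE erefl) fetchP] := rd_ok.
apply: runs_seq; apply: runs_weaken fetchP (leqnn _) _ => s1.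
move=> [ag1 enc1 [cs le_cs rdP]].
have ord1 : ivar s1 order_reg = n by rewrite -[LHS](agree_ivar _ ag1).
have row1 : ivar s1 row_reg = d by rewrite -[LHS](agree_ivar _ ag1).
apply: runs_seq; apply: runs_straight => // ag2.
have inv2 : entry_inv i0 cs q s1 (size cs) (effect row_start s1).
  rewrite /entry_inv /= /upd /= take0 big_nil addn0 subn0; split=> //.
    by split; [exact: (queued_agree ag1 qd)|exact: (marked_agree ag1 mk)].
  have := recorded_agree ag1 rec; apply: eq_recorded => i j _.
  by rewrite /scanned in_nil andbF orbF.
apply: runs_seq; apply: runs_weaken (entriesP rdP inv2) _ _.
  by rewrite leq_mul2r ltnS le_cs orbT.
move=> s3 [[le_k kE] [ag3 ord3 row3] [qd3 mk3] sum3 rec3].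
have {le_k}kE : ivar s3 entry_reg = size cs.
  by apply/eqP; rewrite eqn_leq le_k -subn_eq0 -kE.
apply: runs_straight => // ag4; exists (n - d.+1)%N; first by rewrite mE; lia.
have enc4 : enc (effect row_end s3).
  exact: enc_agree ag4 (enc_agree _ _ ag3 enc1).
have [uq_cs cs_e _] := rdP.
(* Unlisted entries are zero, so the sum over the listed columns is the row sum. *)
have {}sum3 : nvar s3 sum_reg = \sum_j A i0 j.
  rewrite sum3 kE take_size big_uniq //= [RHS](bigID (mem cs)) /= [X in _ + X]big1 ?addr0 //.
  by move=> j; apply: contraNeq; exact: cs_e.
have {}rec3 : recorded (fun i _ => i < d.+1)%N (d.+1 * r) s3.
  have [adj [ll adjE szE signE]] : recorded (fun i _ => i < d.+1)%N (i0 * r + size cs) s3.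
    have := rec3; rewrite kE take_size; apply: eq_recorded => i j ij.
    rewrite /scanned ltnS [in RHS]leq_eqVlt orbC -(val_eqE i i0) /=.
    case: eqP => //= iE; have ii0 : i = i0 by apply: val_inj.
    by rewrite cs_e // -ii0.
  exists adj; split=> //; apply: leq_trans szE _.
  by rewrite mulSn /= addnC leq_add2r.
have d3 : ivar s3 row_reg = d by [].
move: enc4; rewrite /row_inv /row_end /= row_testE /= /upd /= sum3 -/(good i0) !d3.
have [uq qtE qkE] := qd3.
have newq : i0 \notin q by rewrite qE ltnn.
case gi: (good i0); rewrite /= /upd /= ?d3 ?addn1 => enc4.
- exists (rcons q i0); split=> //.
  + split.
      split; first by rewrite rcons_uniq newq.
        by rewrite /= /upd /= size_rcons qtE.
      move=> k x; rewrite size_rcons ltnS leq_eqVlt nth_rcons /= /upd /= qtE.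
      by case: (ltngtP k (size q)) => //= lt_k _; exact: qkE.
    move=> i; rewrite mem_rcons inE ltnS leq_eqVlt /= /upd /=.
    rewrite -val_eqE /=; case: eqP => //= _; exact: mk3.
  + move=> i; rewrite mem_rcons inE qE ltnS [in RHS]leq_eqVlt.
    by rewrite -val_eqE /=; case: eqP => //= iE; rewrite -gi; congr good; apply: val_inj.
- exists q; split=> //.
  + split=> // i; rewrite ltnS leq_eqVlt /= /upd /=.
    case: eqP => [iE _|_]; last exact: mk3.
    by rewrite qE iE ltnn.
  + move=> i; rewrite qE ltnS [in RHS]leq_eqVlt; case: eqP => //= iE.
    have -> : i = i0 by apply: val_inj.
    by rewrite gi andbF.
Qed.

Definition clear_inv m s : Prop :=
  let d := ivar s row_reg in
  [/\ (d <= n)%N /\ m = (n - d)%N, ivar s order_reg = n, enc s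
    & forall k, (k < d)%N -> iarr s head_arr k = 0%N].

Lemma clear_stepP m s : clear_inv m s -> bval s more_rows ->
  exists2 m', (m' < m)%N & clear_inv m' (effect clear_step s).
Proof.
move=> [[le_d mE] ordE enc_s headE]; rewrite /more_rows /= ordE -ltnNge => lt_d.
exists (n - (ivar s row_reg).+1)%N; first by rewrite mE; lia.
have [enc_agree _] := rd_ok.
have := enc_agree _ _ (agree_straight (c := clear_step) s isT) enc_s.
rewrite /clear_inv /= /upd /= addn1 => enc'; split=> // k.
by rewrite ltnS leq_eqVlt /= /upd /=; case: eqP => //= _; exact: headE.
Qed.

(** One summand per stage of [program]; the search dequeues at most n rows and reads at most n r
    edges. *)
Definition program_cost : nat :=
  2 + ((n * (bcost more_rows + max_cost clear_step) + bcost more_rows) +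
  (max_cost init + ((n * (bcost more_rows + (L + row_cost)) + bcost more_rows) +
  (2 + ((n + n * r).+1 * search_cost + max_cost answer))))).

Lemma programP s : enc s -> ivar s order_reg = n ->
  runs program s program_cost (fun s' =>
    ivar s' answer_reg = signs_ok (fun _ _ => true) && [forall i, reaches edge good i]).
Proof.
move=> enc_s ordE; have [enc_agree _] := rd_ok.
apply: runs_seq; apply: (@runs_straight _ (ISet _ _)) => // ag1.
have inv1 : clear_inv n (effect (ISet row_reg (ICst 0)) s).
  by split; rewrite //= /upd ?subn0 //; exact: enc_agree ag1 enc_s.
apply: runs_seq; apply: runs_weaken
  (runs_while (T := max_cost clear_step) _ inv1) (leqnn _) _.
  by move=> m s' inv_s es; apply: runs_straight => // _; exact: clear_stepP es.
move=> {ag1 inv1 enc_s ordE}s [done [_ [[le_d _] ordE enc_s headE]]].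
have {done le_d}headE (k : 'I_n) : iarr s head_arr k = 0%N.
  apply: headE; apply: leq_trans (ltn_ord k) _.
  by move: done; rewrite /more_rows /= ordE negbK.
apply: runs_seq; apply: runs_straight => // ag2.
have inv2 : row_inv n (effect init s).
  exists [::]; rewrite /= /upd /=; split=> //.
  - by rewrite subn0.
  - by split=> //; exact: enc_agree ag2 enc_s.
  - exists (fun _ => [::]); split.
    + by move=> j; rewrite /= /upd /= headE.
    + by [].
    + by rewrite big1.
    + by rewrite /= /upd /=; apply/esym/eqP; rewrite eqb1; apply/'forall_forallP.
apply: runs_seq; apply: runs_weaken
  (runs_while (T := (L + row_cost)%N) row_stepP inv2) (leqnn _) _.
move=> {ag2 inv2 enc_s ordE headE}s.
move=> [done [_ [q [[le_d _] [ordE _] [qd mk] [adj [ll adjE szE signE]] qE]]]].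
have {done} dE : ivar s row_reg = n.
  apply/eqP; rewrite eqn_leq le_d.
  by move: done; rewrite /more_rows /= ordE negbK.
rewrite dE in mk szE.
have {}adjE i j : (i \in adj j) = edge i j by rewrite adjE dE ltn_ord.
have {}qE i : (i \in q) = good i by rewrite qE dE ltn_ord.
have {}signE : ivar s sign_reg = signs_ok (fun _ _ => true).
  by rewrite signE; congr nat_of_bool; apply: eq_signs_ok => i j _; rewrite dE ltn_ord.
apply: runs_seq; apply: (@runs_straight _ (ISet _ _)) => // _.
have inv3 : search_inv edge good (signs_ok (fun _ _ => true)) (n + \sum_j size (adj j))
    (effect (ISet queue_start (ICst 0)) s).
  exists q, adj; split=> //; first by rewrite /= /upd /= subn0.
  split=> [i j|i|i|i j]; rewrite ?adjE ?qE //=.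
    by move=> gi; apply/existsP; exists i; rewrite connect0.
  by rewrite /upd /= take0 andbT.
apply: runs_seq; apply: runs_weaken (searchP inv3) _ _.
  by rewrite leq_mul2r ltnS leq_add2l szE orbT.
move=> s' [ordE' sign' searchE]; apply: runs_straight => // _.
by rewrite /= ordE' searchE sign' eqb1 /upd; case: andb.
Qed.
End Correctness.

(** The constants come from the program text alone; additive terms are absorbed using n > 0. *)
Lemma program_cost_bound : exists C, forall n L r, (0 < n)%N ->
  (program_cost n L r <= C * (n * (L + r + 1)))%N.
Proof.
rewrite /program_cost /row_cost.
move: (bcost _) (max_cost clear_step) (max_cost init) (max_cost row_start)
  entry_cost (max_cost row_end) search_cost (max_cost answer) => a b c d e f g h.
exists (4 + 4 * a + b + c + d + e + f + 2 * g + h + 1)%N => n L r n0.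
have nr : (r <= n * r)%N by rewrite leq_pmull.
nia.
Qed.
End Program.

(** * Sparse and dense inputs *)

Definition sparse_reader (lister : cmd) : row_reader :=
  RowReader lister (IVar list_len) (IGet list_col (IVar entry_reg))
    (NGet list_val (IVar entry_reg)).

Lemma sparse_reader_access (K : numFieldType)
    (enc : forall n, 'M[K]_n -> state K -> Prop) (lister : cmd) :
  sparse_row_format enc lister -> exists a b : nat,
    forall n (A : 'M[K]_n) c, (forall i, (row_nnz A i <= c)%N) ->
    row_access (sparse_reader lister) A (enc n A) (a * c + b) c.
Proof.
move=> [enc_agree [a [b listP]]]; exists a, b => n A c nnz.
split=> [s s'|i s enc_s ordE rowE]; first exact: enc_agree.
have [t [s' [E le_t ag enc' [perm_cs valE]]]] := listP n A i s enc_s rowE.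
exists t, s'; split=> //.
  by apply: leq_trans le_t _; rewrite leq_add2r leq_mul2l nnz orbT.
split=> //; pose cs0 := [seq j <- enum 'I_n | A i j != 0].
have size_cs0 : size cs0 = row_nnz A i.
  rewrite /cs0 size_filter enumT /row_nnz cardE /enum_mem size_filter.
  by apply: eq_count => j; rewrite [RHS]inE.
set len := ivar s' list_len in perm_cs valE.
have lenE : len = size cs0.
  by have := perm_size perm_cs; rewrite size_mkseq size_map.
have cs_lt k : (k < len)%N -> (iarr s' list_col k < n)%N.
  move=> lt_k; have : iarr s' list_col k \in mkseq (iarr s' list_col) len.
    by apply/mapP; exists k => //; rewrite mem_iota.
  by rewrite (perm_mem perm_cs) => /mapP[j _ ->]; exact: ltn_ord.
(* [i] is a mere default: by [cs_lt] every listed column number is in range. *)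
pose cs := [seq insubd i (iarr s' list_col k) | k <- iota 0 len].
have size_cs : size cs = len by rewrite size_map size_iota.
have csE : map val cs = mkseq (iarr s' list_col) len.
  rewrite /cs -map_comp; apply/eq_in_map => k; rewrite mem_iota /= => lt_k.
  by rewrite val_insubd cs_lt.
exists cs; first by rewrite size_cs lenE size_cs0.
split.
- rewrite -(map_inj_uniq val_inj) csE (perm_uniq perm_cs) (map_inj_uniq val_inj).
  by rewrite filter_uniq ?enum_uniq.
- move=> j Aij; rewrite -(mem_map val_inj) csE (perm_mem perm_cs) mem_map; last exact: val_inj.
  by rewrite mem_filter Aij mem_enum.
move=> s'' ag'' _ _; have [lenE'' _ colE'' valE''] := ag'' 0%N.
rewrite size_cs /=; split=> [|j]; first exact/esym.
move: (ivar s'' entry_reg) => k lt_k.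
have nthE : iarr s' list_col k = nth j cs k.
  rewrite (nth_map 0%N) ?size_iota // nth_iota // add0n val_insubd.
  by rewrite cs_lt.
split; first by rewrite -colE''.
by rewrite -valE''; exact: valE.
Qed.

Definition dense_reader : row_reader :=
  RowReader Skip (IVar order_reg) (IVar entry_reg)
    (NGet dense_array (IAdd (IMul (IVar row_reg) (IVar order_reg)) (IVar entry_reg))).

Lemma dense_reader_access (K : numFieldType) n (A : 'M[K]_n) :
  row_access dense_reader A
    (fun s => forall i j : 'I_n, narr s dense_array (i * n + j)%N = A i j) 1 n.
Proof.
split=> [s s' ag sE i j|i s sE ordE rowE].
  by have [_ _ _ <-] := ag 0%N.
exists 1%N, s; split=> //; first exact: ExecSkip.
split=> //; exists (enum 'I_n); first by rewrite size_enum_ord.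
split=> [||s' ag ordE' rowE']; first exact: enum_uniq.
  by move=> j _; rewrite mem_enum.
rewrite /= ordE' rowE' size_enum_ord; split=> // j.
move: (ivar s' entry_reg) => k lt_k.
rewrite nth_enum_ord //; split=> //.
have [_ _ _ <-] := ag 0%N.
by rewrite -[k in LHS](nth_enum_ord j lt_k) sE.
Qed.

(** The two problems differ only in their tests. The cost O(n (L + r + 1)) is linear for L = a c + b
    and r = c, and quadratic for L = 1 and r = n. *)
Lemma decidable_by_search (K : numFieldType) (sign_test row_test : bexp)
    (sign_ok : bool -> K -> bool) (row_ok : K -> bool)
    (D Q : forall n, 'M[K]_n -> Prop) :
  (forall s : state K, bval s sign_test =
     sign_ok (ivar s row_reg == ivar s col_reg) (nvar s val_reg)) ->
  (forall s : state K, bval s row_test = row_ok (nvar s sum_reg)) ->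
  (forall n (A : 'M[K]_n), (0 < n)%N -> D n A -> Q n A <->
     (forall i j, A i j != 0 -> sign_ok (i == j) (A i j)) /\
     (forall i, reaches (fun i j => A i j != 0)
                        (fun i => row_ok (\sum_j A i j)) i)) ->
  decidable_linear_sparse D Q /\ decidable_quadratic_dense D Q.
Proof.
move=> sign_testE row_testE QE.
have answerE n (A : 'M[K]_n) : (0 < n)%N -> D n A ->
    signs_ok A sign_ok (fun _ _ => true) &&
    [forall i, reaches (fun i j => A i j != 0) (fun i => row_ok (\sum_j A i j)) i] =
    `[< Q n A >].
  move=> n0 DA; apply/andP/asboolP => [[/'forall_forallP sA /forallP rA]|].
    by apply/QE => //; split=> // i j Aij; have := sA i j; rewrite Aij.
  move=> /(QE _ _ n0 DA)[sA rA]; split; last exact/forallP.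
  by apply/'forall_forallP => i j; apply/implyP => /= /sA.
split=> [enc lister fmt|].
  have [a [b acc]] := sparse_reader_access fmt.
  exists (program (sparse_reader lister) sign_test row_test) => c.
  have [C costP] := program_cost_bound (sparse_reader lister) sign_test row_test.
  exists (C * (a * c + b + c + 1))%N => n A s n0 DA nnz ordE enc_s.
  rewrite /decides_within -answerE //.
  apply: runs_weaken (programP sign_testE row_testE (acc n A c nnz) enc_s ordE) _ _ => //.
  by apply: leq_trans (costP _ _ _ n0) _; rewrite -mulnA (mulnC n).
exists (program dense_reader sign_test row_test).
have [C costP] := program_cost_bound dense_reader sign_test row_test.
(* Here L + r + 1 = n + 2 <= 3 n. *)
exists (3 * C)%N => n A s n0 DA [ordE sE].
rewrite /decides_within -answerE //.
apply: runs_weaken (programP sign_testE row_testE (dense_reader_access A) sE ordE) _ _ => //.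
apply: leq_trans (costP _ _ _ n0) _.
by rewrite -mulnn; nia.
Qed.

(** Lacking disjunction, [bexp] expresses the two implications as negated conjunctions. *)
Definition L_sign_test : bexp :=
  let diag := BIEq (IVar row_reg) (IVar col_reg) in
  BAnd (BNot (BAnd diag (BNot (BNLe (NCst 0) (NVar val_reg)))))
       (BNot (BAnd (BNot diag) (BNot (BNLe (NVar val_reg) (NCst 0))))).

Theorem mainTheorem6 (R : realType) :
  (decidable_linear_sparse (@substochastic R) (@convergent R) /\
   decidable_quadratic_dense (@substochastic R) (@convergent R)) /\
  (decidable_linear_sparse (@wdd R) (@nonsingular_M_matrix R) /\
   decidable_quadratic_dense (@wdd R) (@nonsingular_M_matrix R)).
Proof.
split.
  (* Convergence imposes no further sign condition, so the sign test is the constant truth 0 = 0. *)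
  apply: (@decidable_by_search R (BIEq (ICst 0) (ICst 0))
    (BNot (BNLe (NCst 1) (NVar sum_reg))) (fun _ _ => true) (fun x => ~~ (1 <= x))) => //.
  move=> n B _ sB; split=> [cB|[_ rB]]; last exact: reaches_convergent.
  by split=> //; exact: convergent_reaches.
apply: (@decidable_by_search _ L_sign_test
  (BNot (BNLe (NVar sum_reg) (NCst 0))) (@L_sign R) (fun x => ~~ (x <= 0))) => //.
- move=> s; rewrite /L_sign /=.
  by case: eqP; rewrite ?negbK ?andbT.
- by move=> n A _ dA; exact: nonsingular_M_matrixP.
Qed.
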